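(* Let $S\subset\mathbb{F}$ be a smooth surface of bidegree $(1,1)$ which is $j$-invariant, i.e. $j(S)=S$, and let $\mathcal{D}_0=\{q\in\mathbb{P}^2:\pi^{-1}(q)\subset S\}$. Then $\mathbb{P}^2\setminus\mathcal{D}_0$ is the maximal domain of an orthogonal complex structure $J_S$; that is, there is an orthogonal complex structure $J_S$ on $\mathbb{P}^2\setminus\mathcal{D}_0$ that does not extend to an orthogonal complex structure on any strictly larger open subset of $\mathbb{P}^2$.
   Context: $\mathbb{P}^2=\mathbb{P}(\mathbb{C}^3)$ (points are row vectors $p=[p_0:p_1:p_2]$), $\mathbb{P}^{2\vee}$ is its dual (points are column vectors $\ell=[\ell_0:\ell_1:\ell_2]^\vee$). The flag manifold is $\mathbb{F}=\{(p,\ell)\in\mathbb{P}^2\times\mathbb{P}^{2\vee}: p\ell=p_0\ell_0+p_1\ell_1+p_2\ell_2=0\}$. Surfaces of bidegree $(1,1)$ are exactly $S_A=\{(p,\ell)\in\mathbb{F}: pA\ell=0\}$ with $A$ a non-scalar complex $3\times3$ matrix. For $p\in\mathbb{P}^2$ let $p^*=[\bar p_0:\bar p_1:\bar p_2]^\vee$, and for $\ell\in\mathbb{P}^{2\vee}$ let $\ell^*=[\bar\ell_0:\bar\ell_1:\bar\ell_2]$. For distinct $\ell,m\in\mathbb{P}^{2\vee}$, $\ell\times m\in\mathbb{P}^2$ is their intersection point. The twistor projection is $\pi:\mathbb{F}\to\mathbb{P}^2$, $\pi(p,\ell)=p^*\times\ell$, with fibers $\pi^{-1}(q)=\{(p,\ell)\in\mathbb{F}: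 q\ell=0,\ pq^*=0\}$. The involution $j:\mathbb{F}\to\mathbb{F}$ is $j(p,\ell)=(\ell^*,p^* )$. An orthogonal complex structure is an (integrable) complex structure $J'$ defined on an open subset of $\mathbb{P}^2$ such that $g_{\mathrm{FS}}(J'X,J'Y)=g_{\mathrm{FS}}(X,Y)$ at each point, where $g_{\mathrm{FS}}$ is the Fubini-Study metric. *)

(* Defs.v *)
From HB Require Import structures.
From mathcomp Require Import all_boot all_order all_algebra.
From mathcomp Require Import complex.
From mathcomp Require Import all_classical all_reals all_analysis.
Set Implicit Arguments.
Unset Strict Implicit.
Unset Printing Implicit Defensive.
Import Order.TTheory GRing.Theory Num.Theory.
Import numFieldNormedType.Exports.
Local Open Scope classical_set_scope.
Local Open Scope ring_scope.
Local Open Scope complex_scope.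


Section Proj.
Variables (K : fieldType) (V : vectType K).

Definition proj := {U : {vspace V} | \dim U == 1%N}.

Lemma dim_pt (v : V) : v != 0 -> \dim <[v]>%VS == 1%N.
Proof. by move=> v0; rewrite dim_vline v0. Qed.

(* [pt v0] is the point [v], where v0 : v != 0. *)
Definition pt (v : V) (v0 : v != 0) : proj := exist _ <[v]>%VS (dim_pt v0).

(* A choice of homogeneous coordinates for a point. *)
Definition hom (p : proj) : V := vpick (val p).

Lemma hom_neq0 (p : proj) : hom p != 0.
Proof.
rewrite vpick0; apply/eqP => p0; have := valP p.
by rewrite /= p0 dimv0.
Qed.

Lemma hom_pt (v : V) (v0 : v != 0) : exists2 c, c != 0 & hom (pt v0) = c *: v.
Proof.
have /vlineP[c hc] : hom (pt v0) \in <[v]>%VS by exact: memv_pick.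
exists c => //; apply: contra_neq (hom_neq0 (pt v0)) => c0.
by rewrite hc c0 scale0r.
Qed.

End Proj.

Section Flag.
Variable R : realType.

Definition P2 := proj 'rV[R[i]]_3.
Definition P2dual := proj 'cV[R[i]]_3.

Definition incident (x : P2 * P2dual) : bool := hom x.1 *m hom x.2 == 0.

Definition flag := {x : P2 * P2dual | incident x}.

Definition adj (m n : nat) (v : 'M[R[i]]_(m, n)) : 'M[R[i]]_(n, m) :=
  (map_mx Num.conj v)^T.

Lemma adj_neq0 (m n : nat) (v : 'M[R[i]]_(m, n)) : v != 0 -> adj v != 0.
Proof. by rewrite /adj trmx_eq0 map_mx_eq0. Qed.

Definition star (p : P2) : P2dual := pt (adj_neq0 (hom_neq0 p)).
Definition stard (l : P2dual) : P2 := pt (adj_neq0 (hom_neq0 l)).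

Definition jpair (x : P2 * P2dual) : P2 * P2dual := (stard x.2, star x.1).

Lemma incident_jpair (x : P2 * P2dual) : incident x -> incident (jpair x).
Proof.
rewrite /incident /jpair /= /star /stard => /eqP hx.
have [c _ ->] := hom_pt (adj_neq0 (hom_neq0 x.2)).
have [d _ ->] := hom_pt (adj_neq0 (hom_neq0 x.1)).
by rewrite -scalemxAl -scalemxAr /adj -trmx_mul -map_mxM hx map_mx0 trmx0 !scaler0.
Qed.

Definition flag_j (f : flag) : flag := exist (fun x => incident x) _ (incident_jpair (valP f)).

(* Indices are read in Z/3, so this is the usual cross product: the row vector
   annihilating both l and m. *)
Definition cross (l m : 'cV[R[i]]_3) : 'rV[R[i]]_3 :=
  \row_(k < 3) (l (k + 1) 0 * m (k + 2%:R) 0 - l (k + 2%:R) 0 * m (k + 1) 0).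

Lemma cross_adj_neq0 (p : 'rV[R[i]]_3) (l : 'cV[R[i]]_3) (c : R[i]) :
  p != 0 -> l != 0 -> c != 0 -> p *m l = 0 -> cross (c *: adj p) l != 0.
Proof.
move=> p0 l0 c0 pl; apply/eqP => h; case/eqP: l0; apply/matrixP => j j0.
rewrite (ord1 j0) mxE {j0}.
pose a := c *: adj p.
have key i k : a i 0 * l k 0 = a k 0 * l i 0.
  have e0 := congr1 (fun M : 'rV[R[i]]_3 => M 0 0) h; have e1 := congr1 (fun M : 'rV[R[i]]_3 => M 0 1) h.
  have e2 := congr1 (fun M : 'rV[R[i]]_3 => M 0 2%:R) h.
  move: e0 e1 e2; rewrite !mxE -/a.
  have o1 : 0 + 1 = 1 :> 'I_3 by apply/val_inj.
  have o2 : 0 + 2%:R = 2%:R :> 'I_3 by apply/val_inj.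
  have o3 : 1 + 1 = 2%:R :> 'I_3 by apply/val_inj.
  have o4 : 1 + 2%:R = 0 :> 'I_3 by apply/val_inj.
  have o5 : 2%:R + 1 = 0 :> 'I_3 by apply/val_inj.
  have o6 : 2%:R + 2%:R = 1 :> 'I_3 by apply/val_inj.
  rewrite o1 o2 o3 o4 o5 o6 => /subr0_eq e0 /subr0_eq e1 /subr0_eq e2.
  have cs (t : 'I_3) : [\/ t = 0, t = 1 | t = 2%:R].
    by case: t => [[|[|[|//]]]] ht; [constructor 1|constructor 2|constructor 3];
      apply/val_inj.
  by case: (cs i) => ->; case: (cs k) => ->.
have : (\sum_i p 0 i * a i 0) * l j 0 = 0.
  rewrite mulr_suml (eq_bigr (fun i => a j 0 * (p 0 i * l i 0))).
    rewrite -mulr_sumr.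
    by have := congr1 (fun M : 'M[R[i]]_1 => M 0 0) pl; rewrite !mxE => ->; rewrite mulr0.
  by move=> i _; rewrite -mulrA key mulrCA.
move/eqP; rewrite mulf_eq0 => /orP[|/eqP //].
rewrite (eq_bigr (fun i => c * `|p 0 i| ^+ 2)); last first.
  by move=> i _; rewrite !mxE normCK mulrCA.
rewrite -mulr_sumr mulf_eq0 (negbTE c0) /= psumr_eq0; last first.
  by move=> i _; rewrite exprn_ge0.
move=> /allP pz; case/eqP: p0; apply/matrixP => i0 i; rewrite (ord1 i0) mxE.
have := pz i (mem_index_enum _).
by rewrite /= expf_eq0 /= normr_eq0 => /eqP.
Qed.

Lemma cross_flag_neq0 (f : flag) :
  cross (hom (star (val f).1)) (hom (val f).2) != 0.
Proof.
have [c c0 ->] := hom_pt (adj_neq0 (hom_neq0 (val f).1)).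
by apply: cross_adj_neq0 (hom_neq0 _) (hom_neq0 _) c0 (eqP (valP f)).
Qed.

Definition twistor (f : flag) : P2 := pt (cross_flag_neq0 f).


Definition surface (A : 'M[R[i]]_3) : set flag :=
  [set f | hom (val f).1 *m A *m hom (val f).2 = 0].

(* Jacobian criterion for the complete intersection p l = p A l = 0 in
   P^2 x P^2dual: the rows are the differentials of these two forms with respect
   to (p, l), in homogeneous coordinates. *)
Definition smooth_surface (A : 'M[R[i]]_3) : Prop :=
  forall f : flag, surface A f ->
    let p := hom (val f).1 in let l := hom (val f).2 in
    \rank (col_mx (row_mx l^T p) (row_mx (A *m l)^T (p *m A))) = 2%N.

Definition D0 (S : set flag) : set P2 :=
  [set q | twistor @^-1` [set q] `<=` S].


(* The k-th chart has real coordinates x = (Re z, Im z), z in C^2; its inverse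
   sends z to the point whose k-th homogeneous coordinate is 1 and whose other
   ones are those of z. *)
Definition zvec (x : 'rV[R]_4) : 'rV[R[i]]_2 :=
  \row_(m < 2) (x 0 (@lshift 2 2 m) +i* x 0 (@rshift 2 2 m)).

Definition insert (a : R[i]) (k : 'I_3) (z : 'rV[R[i]]_2) : 'rV[R[i]]_3 :=
  \row_(j < 3) if unlift k j is Some m then z 0 m else a.

Definition chart_vec (k : 'I_3) (x : 'rV[R]_4) : 'rV[R[i]]_3 :=
  insert 1 k (zvec x).

(* The differential of [chart_vec k] applied to a tangent vector. *)
Definition dchart_vec (k : 'I_3) (X : 'rV[R]_4) : 'rV[R[i]]_3 :=
  insert 0 k (zvec X).

Lemma chart_vec_neq0 (k : 'I_3) (x : 'rV[R]_4) : chart_vec k x != 0.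
Proof.
apply/eqP => /matrixP/(_ 0 k); rewrite !mxE unlift_none => /eqP.
by rewrite oner_eq0.
Qed.

Definition chart (k : 'I_3) (x : 'rV[R]_4) : P2 := pt (chart_vec_neq0 k x).

Definition coords (k : 'I_3) (v : 'rV[R[i]]_3) : 'rV[R]_4 :=
  let z m := v 0 (lift k m) / v 0 k in
  @row_mx R 1 2 2 (\row_m complex.Re (z m)) (\row_m complex.Im (z m)).

(* Change of coordinates from chart a to chart b; meaningful at those x with
   [chart_vec a x 0 b != 0]. *)
Definition transition (a b : 'I_3) (x : 'rV[R]_4) : 'rV[R]_4 :=
  coords b (chart_vec a x).

(* The charts are homeomorphisms onto an open cover of P^2, so this is the
   quotient topology. *)
Definition P2_open (U : set P2) : Prop := forall k, open (chart k @^-1` U).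


Definition herm (u v : 'rV[R[i]]_3) : R[i] := (u *m adj v) 0 0.

(* The Fubini-Study metric in chart k, as the real part of the Hermitian form
   <X, Y>/|v|^2 - <X, v><v, Y>/|v|^4 induced at the point [v]. *)
Definition fubini_study (k : 'I_3) (x X Y : 'rV[R]_4) : R :=
  let v := chart_vec k x in
  let u := dchart_vec k X in let w := dchart_vec k Y in
  complex.Re (herm u w / herm v v - herm u v * herm v w / herm v v ^+ 2).

(* Meaningful for open D, where [differentiable] and the derivatives are local. *)
Fixpoint Cn (n : nat) (V : normedModType R) (D : set 'rV[R]_4)
    (f : 'rV[R]_4 -> V) : Prop :=
  match n with
  | 0 => {in D, continuous f}
  | n'.+1 => (forall x, D x -> differentiable f x) /\
             (forall v : 'rV[R]_4, Cn n' D (fun x => 'D_v f x))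
  end.

Definition smooth_on (V : normedModType R) (D : set 'rV[R]_4)
  (f : 'rV[R]_4 -> V) : Prop := forall n, Cn n D f.

Definition vfield := 'rV[R]_4 -> 'rV[R]_4.

Definition lie (X Y : vfield) : vfield :=
  fun x => 'D_(X x) Y x - 'D_(Y x) X x.

(* Endomorphisms act on row vectors from the right. *)
Definition act (J : 'rV[R]_4 -> 'M[R]_4) (X : vfield) : vfield :=
  fun x => X x *m J x.

Definition nijenhuis (J : 'rV[R]_4 -> 'M[R]_4) (X Y : vfield) : vfield :=
  fun x => lie (act J X) (act J Y) x - act J (lie (act J X) Y) x
           - act J (lie X (act J Y)) x - lie X Y x.

(* A field of endomorphisms of the tangent bundle over a subset of P^2, given by
   its matrices in the three charts; only the values at those (k, x) with
   [chart k x] in the subset matter. *)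
Definition endo_field := 'I_3 -> 'rV[R]_4 -> 'M[R]_4.

(* The matrices in the different charts define the same field on U. *)
Definition compatible (U : set P2) (J : endo_field) : Prop :=
  forall (a b : 'I_3) (x X : 'rV[R]_4),
    U (chart a x) -> chart_vec a x 0 b != 0 ->
    'D_(X *m J a x) (transition a b) x =
    'D_X (transition a b) x *m J b (transition a b x).

Definition eq_on (U : set P2) (J J' : endo_field) : Prop :=
  forall k x, U (chart k x) -> J k x = J' k x.

Record is_OCS (U : set P2) (J : endo_field) : Prop := IsOCS {
  ocs_open : P2_open U;
  ocs_compatible : compatible U J;
  ocs_smooth : forall k, smooth_on (chart k @^-1` U) (J k);
  ocs_square : forall k x, U (chart k x) -> J k x *m J k x = - 1%:M;
  ocs_integrable : forall k (X Y : vfield),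
    smooth_on (chart k @^-1` U) X -> smooth_on (chart k @^-1` U) Y ->
    forall x, U (chart k x) -> nijenhuis (J k) X Y x = 0;
  ocs_orthogonal : forall k x X Y, U (chart k x) ->
    fubini_study k x (X *m J k x) (Y *m J k x) = fubini_study k x X Y
}.

End Flag.

(* Main.v *)
Require Import Defs.
From mathcomp Require Import all_boot all_order all_algebra.
From mathcomp Require Import complex.
From mathcomp Require Import all_classical all_reals all_analysis.
From mathcomp Require Import ring lra.
Import Order.TTheory GRing.Theory Num.Theory.
Import numFieldNormedType.Exports.
Set Implicit Arguments.
Unset Strict Implicit.
Unset Printing Implicit Defensive.
Local Open Scope classical_set_scope.
Local Open Scope ring_scope.
Local Open Scope complex_scope.

(** After subtracting a scalar matrix and rescaling, which changes neither the flags of the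
    surface nor its fibers, a smooth j-invariant surface is the surface of a Hermitian
    matrix H with simple eigenvalues (normal_form). A flag over q is a point p orthogonal
    to q together with the line l through p and q, and it lies on the surface iff p is an
    eigenvector of the compression of H to the plane orthogonal to q. If this compression
    is not scalar there are two such points, exchanged by j and orthogonal to each other,
    and they are distinguished globally by the order of the two real eigenvalues; if it is
    scalar the whole fiber is in the surface (D0_disc).

    So away from the locus D0 there is an involution T of the plane orthogonal to q, +1 and
    -1 on the two eigenlines. Identifying that plane with C^3 / q, the tangent space of the
    projective plane at [q], the structure J_S is v |-> i v T. It is an orthogonal almost
    complex structure because T is a Hermitian involution. It is smooth because T is the
    trace-free part of the compression divided by the square root of its positive
    discriminant.

    Integrability is the statement that the section defined by p is holomorphic. With P and
    L the projectors onto the eigenlines and Q the one onto q, differentiate P H L = 0: as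
    the two eigenvalues differ, the block P dP L vanishes along one type of complex tangent
    vectors (frame_variation_offdiag0). This yields the Cauchy-Riemann equation
    D_vJ T = i (D_v T) T on the orthogonal plane, then D_vJ M = (D_v M) M for the matrix M
    of J_S in a chart (jmx_cauchy_riemann), and this equation makes the Nijenhuis tensor
    vanish identically (nijenhuis_cauchy_riemann).

    For maximality, let the compression at q be the scalar t. By smoothness q is not an
    eigenvector, so q H has a nonzero component b orthogonal to q. The vector n orthogonal
    to q and b satisfies n H = t n, hence remains an eigenvector of the compression at the
    points q + s b, whose other eigenvalue crosses t with nonzero speed at s = 0. The
    eigenvalue of T on n thus jumps between 1 and -1 (sign_along_path), and J_S has no
    continuous extension to [q] (jfield_maximal). *)


(** * Variation of a triple of idempotents *)

Section FrameVariation.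
Variables (F : fieldType) (M : algType F).
Implicit Types P L Q H : M.

(** First-order change of complementary idempotents P, L, Q with P H L = L H P = 0
    for a fixed H: the relations are the Leibniz rule applied to these products.
    They are linear in (dP, dL, dQ), so that complex combinations of tangent
    vectors are allowed. *)
Definition frame_variation (P L Q H dP dL dQ : M) : Prop :=
  [/\ dP * P + P * dP = dP /\ dL * L + L * dL = dL,
      dP * L + P * dL = 0 /\ dL * P + L * dP = 0,
      dP * Q + P * dQ = 0 /\ dL * Q + L * dQ = 0,
      dQ * P + Q * dP = 0 /\ dQ * L + Q * dL = 0
    & dP * H * L + P * H * dL = 0 /\ dL * H * P + L * H * dP = 0].

Lemma frame_variation_comb (P L Q H dP dL dQ dP' dL' dQ' : M) (c : F) :
  frame_variation P L Q H dP dL dQ -> frame_variation P L Q H dP' dL' dQ' ->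
  frame_variation P L Q H (dP + c *: dP') (dL + c *: dL') (dQ + c *: dQ').
Proof.
have add (a b x y x' y' e e' : M) : x * b + a * y = e -> x' * b + a * y' = e' ->
    (x + c *: x') * b + a * (y + c *: y') = e + c *: e'.
  move=> <- <-; rewrite mulrDl mulrDr scalerDr -scalerAl -scalerAr.
  by rewrite !addrA; congr (_ + _); rewrite addrAC.
have add0 (a b x y x' y' : M) : x * b + a * y = 0 -> x' * b + a * y' = 0 ->
    (x + c *: x') * b + a * (y + c *: y') = 0.
  by move=> h /(add _ _ _ _ _ _ _ _ h) ->; rewrite scaler0 addr0.
move=> [[p1 p2] [p3 p4] [p5 p6] [p7 p8] [p9 pa]].
move=> [[q1 q2] [q3 q4] [q5 q6] [q7 q8] [q9 qa]].
split; split; try by [exact: add | exact: add0].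
  by rewrite -[X in X + _]mulrA; apply: add0; rewrite mulrA.
by rewrite -[X in X + _]mulrA; apply: add0; rewrite mulrA.
Qed.

Lemma frame_variation_sym (P L Q H dP dL dQ : M) :
  frame_variation P L Q H dP dL dQ -> frame_variation L P Q H dL dP dQ.
Proof. by case=> [[? ?] [? ?] [? ?] [? ?] [? ?]]; split. Qed.

Lemma idem_diag0 (P dP : M) : P * P = P -> dP * P + P * dP = dP -> P * dP * P = 0.
Proof.
move=> PP dPP; apply: (addrI (P * dP * P)); rewrite addr0.
transitivity (P * (dP * P + P * dP) * P); last by rewrite dPP.
by rewrite mulrDr mulrDl !mulrA PP -[P * dP * P * P]mulrA PP.
Qed.

Section Blocks.
Variables (P L Q H : M).
Hypotheses (PP : P * P = P) (LL : L * L = L) (QQ : Q * Q = Q).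
Hypotheses (PL : P * L = 0) (LP : L * P = 0).
Variables (dP dL dQ : M).
Hypotheses (D : frame_variation P L Q H dP dL dQ).

(** Multiplying a Leibniz relation by an idempotent on either side leaves one block;
    in this way dP and dL are reduced to dQ and to P dP L. *)
Lemma frame_variation_blocks :
  [/\ P * dP * P = 0 /\ P * dL * P = 0,
      P * dL * L = - (P * dP * L),
      Q * dP * P = - (Q * dQ * P) /\ Q * dL * P = 0 &
      Q * dP * L = 0 /\ Q * dL * L = - (Q * dQ * L)].
Proof.
move: D => [[p1 p2] [p3 p4] [p5 p6] [p7 p8] [p9 pa]].
have k (a b x y u v : M) : x * b + a * y = 0 -> u * (x * b) * v + u * (a * y) * v = 0.
  by move=> e; rewrite -mulrDl -mulrDr e mulr0 mul0r.
split.
- split; first exact: idem_diag0.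
  by have := k _ _ _ _ P P p4; rewrite !mulrA PL !mul0r addr0 -mulrA PP.
- have := k _ _ _ _ P L p3; rewrite !mulrA PP -[P * dP * L * L]mulrA LL.
  by move/eqP; rewrite addrC addr_eq0 => /eqP.
- split.
    have := k _ _ _ _ Q P p7; rewrite !mulrA QQ -[Q * dQ * P * P]mulrA PP.
    by move/eqP; rewrite addrC addr_eq0 => /eqP.
  by have := k _ _ _ _ Q P p8; rewrite !mulrA QQ -[Q * dQ * L * P]mulrA LP mulr0 add0r.
- split.
    by have := k _ _ _ _ Q L p7; rewrite !mulrA QQ -[Q * dQ * P * L]mulrA PL mulr0 add0r.
  have := k _ _ _ _ Q L p8; rewrite !mulrA QQ -[Q * dQ * L * L]mulrA LL.
  by move/eqP; rewrite addrC addr_eq0 => /eqP.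
Qed.
End Blocks.

Section OffDiagonal.
Variables (P L Q H : M) (a b i : F).
Hypotheses (e1 : P + L + Q = 1) (PP : P * P = P) (LL : L * L = L) (QQ : Q * Q = Q).
Hypotheses (PL : P * L = 0) (PQ : P * Q = 0) (QP : Q * P = 0).
Hypotheses (LQ : L * Q = 0) (QL : Q * L = 0) (PHL : P * H * L = 0).
Hypotheses (PHP : P * H * P = a *: P) (LHL : L * H * L = b *: L) (ab : a != b).

(** The (P, L) block of the derivative of P H L = 0 is (b - a) P dP L up to terms
    passing through Q, and those vanish by the two conditions on dQ. This is where
    the eigenvalues a and b of the compression of H have to be distinct. *)
Lemma frame_variation_offdiag0 (dP dL dQ : M) : frame_variation P L Q H dP dL dQ ->
  P * dQ * Q = 0 -> Q * dQ * L = 0 -> P * dP * L = 0.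
Proof.
move=> D PdQ QdQ; have [dPP dLL] : dP * P + P * dP = dP /\ dL * L + L * dL = dL by case: D.
have [dPL dPQ dQL dPHL] : [/\ dP * L + P * dL = 0, dP * Q + P * dQ = 0,
    dQ * L + Q * dL = 0 & dP * H * L + P * H * dL = 0].
  by case: D => [_ [? _] [? _] [_ ?] [? _]].
have PdP := idem_diag0 PP dPP; have LdL := idem_diag0 LL dLL.
have PdPQ : P * dP * Q = 0.
  move/(congr1 (fun x => P * x * Q)): dPQ.
  by rewrite mulrDr mulrDl !mulrA PP PdQ addr0 -mulrA QQ mulr0 mul0r.
have QdLL : Q * dL * L = 0.
  move/(congr1 (fun x => Q * x * L)): dQL.
  by rewrite mulrDr mulrDl !mulrA QQ QdQ mul0r add0r mulr0 mul0r.
have PdLL : P * dL * L = - (P * dP * L).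
  apply/eqP; rewrite -addr_eq0 addrC; apply/eqP.
  rewrite -[RHS](mul0r L) -(mulr0 P) -dPL.
  by rewrite mulrDr mulrDl !mulrA PP -[P * dP * L * L]mulrA LL.
have h1 : P * dP * H * L = b *: (P * dP * L).
  rewrite -[P * dP]mulr1 -e1 !mulrDr PdP PdPQ add0r addr0 -{1}LL.
  by rewrite -!mulrA [L * (H * L)]mulrA LHL -!scalerAr.
have h2 : P * H * dL * L = a *: (P * dL * L).
  rewrite -[P * H]mulr1 -e1 !mulrDr PHP PHL addr0 !mulrDl.
  rewrite -[P * H * Q * dL * L]mulrA -[P * H * Q * _]mulrA [Q * (dL * L)]mulrA.
  by rewrite QdLL mulr0 addr0 -!scalerAl.
move/(congr1 (fun x => P * x * L)): dPHL.
rewrite mulrDr mulrDl !mulrA PP -[X in X + _]mulrA LL h1 h2 PdLL mulr0 mul0r.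
rewrite scalerN -scalerBl => /eqP; rewrite scaler_eq0 subr_eq0.
by rewrite eq_sym (negbTE ab) => /eqP.
Qed.

(** The hypothesis on dQ' says that the second direction is the image of the first
    under multiplication by i on P and by -i on L. Then dQ - i dQ' has no (P, Q)
    and no (Q, L) block, so the preceding lemma kills P (dP - i dP') L. *)
Lemma frame_variation_offdiag (dP dL dQ dP' dL' dQ' : M) : i * i = -1 ->
  frame_variation P L Q H dP dL dQ -> frame_variation P L Q H dP' dL' dQ' ->
  dQ' = i *: (dQ * (P - L) - (P - L) * dQ) ->
  P * dP' * L = - i *: (P * dP * L).
Proof.
move=> ii D D' EQ; have h : P * (dP - i *: dP') * L = 0.
  rewrite -scaleNr; apply: (frame_variation_offdiag0 (frame_variation_comb _ D D')).
  - rewrite EQ scalerA mulNr ii opprK scale1r mulrDr mulrDl mulrBr mulrBl !mulrA.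
    rewrite -[X in _ + (X - _)]mulrA mulrBl PQ LQ subrr mulr0 sub0r.
    by rewrite mulrBr PP PL subr0 subrr.
  - rewrite EQ scalerA mulNr ii opprK scale1r mulrDr mulrDl mulrBr mulrBl !mulrA.
    rewrite -[X in _ + (X - _)]mulrA mulrBl PL LL sub0r mulrN.
    by rewrite mulrBr QP QL subr0 !mul0r subr0 subrr.
move/eqP: h; rewrite mulrBr mulrBl subr_eq0 -scalerAr -scalerAl => /eqP ->.
by rewrite scalerA mulNr ii opprK scale1r.
Qed.
End OffDiagonal.

(** Cauchy-Riemann equation for the involution T = P - L, checked block by block.
    The (P, L) block is the preceding lemma and the (L, P) block its mirror image
    (exchange P with L and i with -i); the blocks starting in Q are those of dQ,
    and the diagonal blocks vanish. *)
Lemma frame_variation_holomorphic (P L Q H : M) (a b i : F) (dP dL dQ dP' dL' dQ' : M) :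
  P + L + Q = 1 -> P * P = P -> L * L = L -> Q * Q = Q ->
  P * L = 0 -> L * P = 0 -> P * Q = 0 -> Q * P = 0 -> L * Q = 0 -> Q * L = 0 ->
  P * H * L = 0 -> L * H * P = 0 -> P * H * P = a *: P -> L * H * L = b *: L ->
  a != b -> i * i = -1 ->
  frame_variation P L Q H dP dL dQ -> frame_variation P L Q H dP' dL' dQ' ->
  dQ' = i *: (dQ * (P - L) - (P - L) * dQ) ->
  (dP' - dL') * (P + L) = i *: ((dP - dL) * (P - L)).
Proof.
move=> e1 PP LL QQ PL LP PQ QP LQ QL PHL LHP PHP LHL ab ii D D' EQ.
have Ds := frame_variation_sym D; have Ds' := frame_variation_sym D'.
have [[b1 b2] b3 [b4 b5] [b6 b7]] := frame_variation_blocks PP LL QQ PL LP D.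
have [[c1 c2] c3 [c4 c5] [c6 c7]] := frame_variation_blocks LL PP QQ LP PL Ds.
have [[b1' b2'] b3' [b4' b5'] [b6' b7']] := frame_variation_blocks PP LL QQ PL LP D'.
have [[c1' c2'] c3' [c4' c5'] [c6' c7']] := frame_variation_blocks LL PP QQ LP PL Ds'.
have dPL := frame_variation_offdiag e1 PP LL QQ PL PQ QP LQ QL PHL PHP LHL ab ii D D' EQ.
have dLP : L * dL' * P = i *: (L * dL * P).
  have e1' : L + P + Q = 1 by rewrite [L + P]addrC.
  have ba : b != a by rewrite eq_sym.
  have ii' : (- i) * (- i) = -1 by rewrite mulrNN.
  have EQ' : dQ' = - i *: (dQ * (L - P) - (L - P) * dQ).
    by rewrite EQ -[L - P]opprB mulrN mulNr -opprD scaleNr scalerN opprK.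
  rewrite (frame_variation_offdiag e1' LL PP QQ LP LQ QL PQ QP LHP LHL PHP ba ii' Ds Ds' EQ').
  by rewrite opprK.
have QT : Q * (P - L) = 0 by rewrite mulrBr QP QL subrr.
have TP : (P - L) * P = P by rewrite mulrBl PP LP subr0.
have TL : (P - L) * L = - L by rewrite mulrBl PL LL sub0r.
have QdT X dX : dX = dQ * (P - L) - (P - L) * dQ -> Q * dX * X = Q * dQ * ((P - L) * X).
  by move=> ->; rewrite [Q * (_ - _)]mulrBr [Q * ((P - L) * dQ)]mulrA QT mul0r subr0 !mulrA.
have QP' : Q * dQ' * P = i *: (Q * dQ * P).
  by rewrite EQ -scalerAr -scalerAl; congr (_ *: _); rewrite (QdT P _ erefl) TP.
have QL' : Q * dQ' * L = - i *: (Q * dQ * L).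
  rewrite EQ -scalerAr -scalerAl scaleNr -scalerN; congr (_ *: _).
  by rewrite (QdT L _ erefl) TL mulrN.
have KP : (dP' - dL') * P = i *: ((dP - dL) * P).
  rewrite -[LHS]mul1r -[(dP - dL) * P]mul1r -e1.
  rewrite !(mulrDl, mulrDr, mulrBr, mulrBl, mulrA, mulNr, mulrN).
  rewrite b1 b2 b1' b2' c3 c3' b4 b5 b4' b5' dLP QP' !scalerDr !scalerN.
  by rewrite !scaler0 ?oppr0.
have KL : (dP' - dL') * L = - i *: ((dP - dL) * L).
  rewrite -[LHS]mul1r -[(dP - dL) * L]mul1r -e1.
  rewrite !(mulrDl, mulrDr, mulrBr, mulrBl, mulrA, mulNr, mulrN).
  rewrite b3 b3' c1 c1' c2 c2' b6 b7 b6' b7' dPL QL' !scalerDr !scalerN.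
  by rewrite !scaler0 ?oppr0.
by rewrite mulrDr KP KL mulrBr scalerBr scaleNr.
Qed.

End FrameVariation.

(** * Hermitian linear algebra and the splitting of the orthogonal plane *)

Section Adjoint.
Variable R : realType.
Local Notation C := R[i].

Lemma conjcM (x y : C) : (x * y)^*%C = x^*%C * y^*%C.
Proof. exact: rmorphM. Qed.
Lemma conjcB (x y : C) : (x - y)^*%C = x^*%C - y^*%C.
Proof. exact: rmorphB. Qed.

Lemma adjmxE m n (A : 'M[C]_(m, n)) i j : adj A i j = (A j i)^*%C.
Proof. by rewrite !mxE. Qed.
Lemma adjmxK m n (A : 'M[C]_(m, n)) : adj (adj A) = A.
Proof. by apply/matrixP => i j; rewrite !adjmxE conjcK. Qed.
Lemma adjmxM m n p (A : 'M[C]_(m, n)) (B : 'M[C]_(n, p)) :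
  adj (A *m B) = adj B *m adj A.
Proof. by rewrite /adj map_mxM trmx_mul. Qed.
Lemma adjmxB m n (A B : 'M[C]_(m, n)) : adj (A - B) = adj A - adj B.
Proof. by rewrite /adj map_mxB linearB. Qed.
Lemma adjmxD m n (A B : 'M[C]_(m, n)) : adj (A + B) = adj A + adj B.
Proof. by rewrite /adj map_mxD linearD. Qed.
Lemma adjmxN m n (A : 'M[C]_(m, n)) : adj (- A) = - adj A.
Proof. by rewrite /adj map_mxN linearN. Qed.
Lemma adjmxZ m n c (A : 'M[C]_(m, n)) : adj (c *: A) = c^*%C *: adj A.
Proof. by rewrite /adj map_mxZ linearZ. Qed.
Lemma adjmx1 n : adj (1%:M : 'M[C]_n) = 1%:M.
Proof. by rewrite /adj map_mx1 trmx1. Qed.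
Lemma adjmx0 m n : adj (0 : 'M[C]_(m, n)) = 0.
Proof. by rewrite /adj map_mx0 trmx0. Qed.
Lemma adjmx_eq0 m n (A : 'M[C]_(m, n)) : (adj A == 0) = (A == 0).
Proof. by rewrite /adj trmx_eq0 map_mx_eq0. Qed.
Lemma mul_adjC n (u w : 'rV[C]_n) : u *m adj w = 0 -> w *m adj u = 0.
Proof. by move=> h; apply/eqP; rewrite -adjmx_eq0 adjmxM adjmxK h. Qed.
Lemma mxtr_adj n (A : 'M[C]_n) : \tr (adj A) = (\tr A)^*%C.
Proof. by rewrite /adj mxtrace_tr -trace_map_mx. Qed.

Lemma trace_mul_adj m n (A : 'M[C]_(m, n)) :
  \tr (A *m adj A) = \sum_i \sum_j `|A i j| ^+ 2.
Proof.
apply: eq_bigr => i _; rewrite mxE; apply: eq_bigr => j _.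
by rewrite adjmxE sqr_normc.
Qed.

Lemma trace_mul_adj_ge0 m n (A : 'M[C]_(m, n)) : 0 <= \tr (A *m adj A).
Proof. by rewrite trace_mul_adj; do 2![apply: sumr_ge0 => ? _]; rewrite exprn_ge0. Qed.

Lemma trace_mul_adj_eq0 m n (A : 'M[C]_(m, n)) : \tr (A *m adj A) = 0 -> A = 0.
Proof.
rewrite trace_mul_adj => /eqP; rewrite psumr_eq0; last first.
  by move=> i _; apply: sumr_ge0 => ? _; rewrite exprn_ge0.
move=> /allP h; apply/matrixP => i j; rewrite mxE.
have := h i (mem_index_enum _); rewrite /= psumr_eq0; last by move=> *; rewrite exprn_ge0.
by move=> /allP /(_ j (mem_index_enum _)) /=; rewrite expf_eq0 /= normr_eq0 => /eqP.
Qed.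

Definition sqnorm (q : 'rV[C]_3) : R := complex.Re (herm q q).

Lemma hermE (u v : 'rV[C]_3) : u *m adj v = (herm u v)%:M.
Proof. by rewrite [LHS]mx11_scalar. Qed.

Lemma ge0_Re (z : C) : 0 <= z -> z = (complex.Re z)%:C.
Proof. by move=> /ger0_real /RRe_real. Qed.

Lemma sqnormE (q : 'rV[C]_3) : herm q q = (sqnorm q)%:C.
Proof.
apply: ge0_Re; suff -> : herm q q = \tr (q *m adj q) by exact: trace_mul_adj_ge0.
by rewrite hermE mxtrace_scalar.
Qed.

Lemma sqnorm_gt0 (q : 'rV[C]_3) : q != 0 -> 0 < sqnorm q.
Proof.
move=> q0; rewrite -ltcR -sqnormE lt_neqAle.
have hE : herm q q = \tr (q *m adj q) by rewrite hermE mxtrace_scalar.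
rewrite hE trace_mul_adj_ge0 andbT eq_sym; apply: contra_neq q0.
exact: trace_mul_adj_eq0.
Qed.

End Adjoint.

(** Cayley-Hamilton in dimension three with the coefficients written by traces, up to
    a factor 2; the constant d is twice the determinant. *)
Lemma cayley_hamilton3 (K : fieldType) (X : 'M[K]_3) :
  exists d : K, 2%:R *: (X *m X *m X) - (2%:R * \tr X) *: (X *m X)
    + (\tr X ^+ 2 - \tr (X *m X)) *: X = d%:M.
Proof.
pose f (i j : nat) : K := X (inord i) (inord j).
have fE : X = \matrix_(i, j) f i j.
  by apply/matrixP => i j; rewrite mxE /f !inord_val.
rewrite fE; move: f {fE} => f {X}.
exists (2%:R * (f 0%N 0%N * (f 1%N 1%N * f 2%N 2%N - f 1%N 2%N * f 2%N 1%N)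
   - f 0%N 1%N * (f 1%N 0%N * f 2%N 2%N - f 1%N 2%N * f 2%N 0%N)
   + f 0%N 2%N * (f 1%N 0%N * f 2%N 1%N - f 1%N 1%N * f 2%N 0%N))).
apply/matrixP => i j; rewrite /mxtrace.
rewrite !(mxE, big_ord_recl, big_ord0) /=.
case: i => [[|[|[|//]]] hi]; case: j => [[|[|[|//]]] hj];
rewrite /bump /= ?add1n ?mulr0n ?mulr1n; ring.
Qed.

(** On the two-dimensional kernel of Q, B is a traceless 2 x 2 matrix, so its square is
    scalar. Comparing Cayley-Hamilton for B and for B + Q gives this without choosing
    a basis of that plane. *)
Lemma sqr_tracefree_complement (K : fieldType) (B Q : 'M[K]_3) :
  B *m Q = 0 -> Q *m B = 0 -> Q *m Q = Q -> \tr B = 0 -> \tr Q = 1 ->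
  2%:R *: (B *m B) = \tr (B *m B) *: (1%:M - Q).
Proof.
move=> BQ QB QQ trB trQ.
have [d0 h0] := cayley_hamilton3 B; have [d1 h1] := cayley_hamilton3 (B + Q).
move: h1 h0.
have E2 : (B + Q) *m (B + Q) = B *m B + Q.
  by rewrite mulmxDl !mulmxDr BQ QB QQ addr0 add0r.
have E3 : (B + Q) *m (B + Q) *m (B + Q) = B *m B *m B + Q.
  rewrite E2 mulmxDl !mulmxDr -[B *m B *m Q]mulmxA BQ mulmx0.
  by rewrite QB QQ addr0 add0r.
rewrite E3 E2 !linearD /= trB trQ; set D := \tr (B *m B).
rewrite add0r !mulr0 scale0r subr0.
rewrite expr0n expr1n /= sub0r mulr1 => h1 h0.
have d00 : d0 = 0.
  have := congr1 (fun X => \tr (X *m Q)) h0.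
  rewrite /= mul_scalar_mx mxtraceZ trQ mulr1 => <-.
  rewrite mulmxDl -!scalemxAl -mulmxA !BQ.
  by rewrite mulmx0 !scaler0 addr0 mxtrace0.
have d1E : d1 = - D.
  have := congr1 (fun X => \tr (X *m Q)) h1.
  rewrite /= mul_scalar_mx mxtraceZ trQ mulr1 => <-.
  rewrite !(mulmxDl, mulNmx) -!scalemxAl -!mulmxA !BQ.
  rewrite ?mulmx0 ?scaler0 QQ ?(linearD, linearN, linearZ, linear0) /=.
  rewrite ?linearD ?linearN ?linearZ ?linear0 /= ?linearN ?linearZ /= trQ.
  ring.
apply/matrixP => i j.
have := congr1 (fun X : 'M[K]_3 => X i j) h0; have := congr1 (fun X : 'M[K]_3 => X i j) h1.
rewrite d00 d1E; move: (B *m B *m B) (B *m B) => B3 B2.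
have lc (l r l1 r1 x y : K) : l = r -> l1 = r1 -> x - y = (l - r) - (l1 - r1) -> x = y.
  by move=> -> -> e; apply/eqP; rewrite -subr_eq0 e !subrr.
by rewrite !mxE => e1 e0; apply: (lc _ _ _ _ _ _ e0 e1); case: (i == j) => /=; ring.
Qed.

Section Split.
Variable R : realType.
Local Notation C := R[i].
Implicit Types (q : 'rV[C]_3) (H : 'M[C]_3).

(** Vectors are rows and matrices act from the right; proj_line q is the Hermitian
    projector onto the line of q, proj_perp q the one onto the orthogonal plane, which
    is the tangent space of the projective plane at [q] up to scale. *)
Definition proj_line q : 'M[C]_3 := (sqnorm q)^-1%:C *: (adj q *m q).
Definition proj_perp q : 'M[C]_3 := 1%:M - proj_line q.
Definition compress H q : 'M[C]_3 := proj_perp q *m H *m proj_perp q.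
Definition half_tr H q : C := \tr (compress H q) / 2%:R.
Definition tracefree H q : 'M[C]_3 := compress H q - half_tr H q *: proj_perp q.
(** If the compression of H to the plane orthogonal to q has eigenvalues t + d and t - d,
    then disc H q is d ^ 2. *)
Definition disc H q : R := complex.Re (\tr (tracefree H q *m tracefree H q)) / 2%:R.
Definition gap H q : R := Num.sqrt (disc H q).
(** The involution of the plane orthogonal to q whose eigenlines are those of the
    compression of H, the larger eigenvalue giving +1. Ordering the eigenvalues is what
    makes the choice of one of the two points of the surface over [q] global. *)
Definition splitting H q : 'M[C]_3 := (gap H q)^-1%:C *: tracefree H q.

Variables (H : 'M[C]_3) (q : 'rV[C]_3).
Hypotheses (q0 : q != 0).
Local Notation Q := (proj_line q).
Local Notation Pi := (proj_perp q).
Local Notation B := (tracefree H q).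
Local Notation T := (splitting H q).

Lemma rcinv (r : R) : (r^-1)%:C = (r%:C)^-1.
Proof. by rewrite fmorphV. Qed.

Lemma sqnormC_neq0 : (sqnorm q)%:C != 0.
Proof. by rewrite fmorph_eq0 gt_eqF // sqnorm_gt0. Qed.

Lemma mul_line : q *m Q = q.
Proof.
rewrite -scalemxAr mulmxA hermE mul_scalar_mx scalerA sqnormE rcinv.
by rewrite mulVf ?scale1r // sqnormC_neq0.
Qed.

Lemma adj_line : adj Q = Q.
Proof. by rewrite adjmxZ adjmxM adjmxK conjc_real. Qed.

Lemma line_idem : Q *m Q = Q.
Proof. by rewrite {1}/proj_line -scalemxAl -mulmxA mul_line. Qed.

Lemma tr_line : \tr Q = 1.
Proof.
rewrite mxtraceZ mxtrace_mulC hermE mxtrace_scalar sqnormE rcinv mulVf //.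
exact: sqnormC_neq0.
Qed.

Lemma line_perp : Q *m Pi = 0.
Proof. by rewrite mulmxBr mulmx1 line_idem subrr. Qed.
Lemma perp_line : Pi *m Q = 0.
Proof. by rewrite mulmxBl mul1mx line_idem subrr. Qed.
Lemma perp_idem : Pi *m Pi = Pi.
Proof. by rewrite {1}/proj_perp mulmxBl mul1mx line_perp subr0. Qed.
Lemma adj_perp : adj Pi = Pi.
Proof. by rewrite adjmxB adjmx1 adj_line. Qed.
Lemma tr_perp : \tr Pi = 2%:R.
Proof. by rewrite linearB /= mxtrace1 tr_line mulrSr addrK. Qed.
Lemma mul_perp : q *m Pi = 0.
Proof. by rewrite mulmxBr mulmx1 mul_line subrr. Qed.
Lemma perp_adj : Pi *m adj q = 0.
Proof. by rewrite -[LHS]adjmxK adjmxM adjmxK adj_perp mul_perp adjmx0. Qed.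

Lemma tracefree_perp : B *m Pi = B.
Proof. by rewrite mulmxBl -scalemxAl perp_idem -mulmxA perp_idem. Qed.
Lemma perp_tracefree : Pi *m B = B.
Proof. by rewrite mulmxBr -scalemxAr perp_idem !mulmxA perp_idem. Qed.
Lemma tracefree_line : B *m Q = 0.
Proof. by rewrite -tracefree_perp -mulmxA perp_line mulmx0. Qed.
Lemma line_tracefree : Q *m B = 0.
Proof. by rewrite -perp_tracefree mulmxA line_perp mul0mx. Qed.
Lemma tr_tracefree : \tr B = 0.
Proof.
by rewrite linearB /= mxtraceZ tr_perp /half_tr divfK ?subrr // pnatr_eq0.
Qed.

Hypothesis (HH : adj H = H).

Lemma adj_compress : adj (compress H q) = compress H q.
Proof. by rewrite !adjmxM HH adj_perp mulmxA. Qed.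
Lemma conj_half_tr : (half_tr H q)^*%C = half_tr H q.
Proof.
by rewrite /half_tr conjcM conjc_inv conjc_nat -mxtr_adj adj_compress.
Qed.
Lemma adj_tracefree : adj B = B.
Proof. by rewrite adjmxB adjmxZ conj_half_tr adj_perp adj_compress. Qed.

Lemma tr_tracefree_sqr : \tr (B *m B) = 2%:R * (disc H q)%:C.
Proof.
rewrite rmorphM /= rcinv rmorph_nat mulrC divfK ?pnatr_eq0 //.
by apply: ge0_Re; rewrite -{2}adj_tracefree trace_mul_adj_ge0.
Qed.

Lemma disc_ge0 : 0 <= disc H q.
Proof.
rewrite -lecR -(pmulr_rge0 _ (ltr0n _ 2)) -tr_tracefree_sqr.
by rewrite -{2}adj_tracefree trace_mul_adj_ge0.
Qed.

Lemma disc_eq0 : disc H q = 0 -> B = 0.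
Proof.
by move=> d0; apply: trace_mul_adj_eq0; rewrite adj_tracefree tr_tracefree_sqr d0 mulr0.
Qed.

Lemma tracefree_sqr : B *m B = (disc H q)%:C *: Pi.
Proof.
have two : 2%:R != 0 :> C by rewrite pnatr_eq0.
apply: (scalerI two); rewrite scalerA -tr_tracefree_sqr.
by apply: sqr_tracefree_complement; rewrite ?tracefree_line ?line_tracefree ?line_idem ?tr_tracefree ?tr_line.
Qed.

End Split.

Section Splitting.
Variable R : realType.
Local Notation C := R[i].
Variables (H : 'M[C]_3) (q : 'rV[C]_3).
Hypotheses (q0 : q != 0) (HH : adj H = H) (d0 : 0 < disc H q).
Local Notation Q := (proj_line q).
Local Notation Pi := (proj_perp q).
Local Notation B := (tracefree H q).
Local Notation T := (splitting H q).

Lemma gap_gt0 : 0 < gap H q.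
Proof. by rewrite sqrtr_gt0. Qed.
Lemma gapC_neq0 : (gap H q)%:C != 0.
Proof. by rewrite fmorph_eq0 gt_eqF // gap_gt0. Qed.

Lemma gap_splitting : (gap H q)%:C *: T = B.
Proof. by rewrite scalerA rcinv mulfV ?scale1r // gapC_neq0. Qed.

Lemma splitting_perp : T *m Pi = T.
Proof. by rewrite -scalemxAl tracefree_perp. Qed.
Lemma perp_splitting : Pi *m T = T.
Proof. by rewrite -scalemxAr perp_tracefree. Qed.
Lemma mul_splitting : q *m T = 0.
Proof. by rewrite -perp_splitting mulmxA mul_perp // mul0mx. Qed.
Lemma splitting_adj : T *m adj q = 0.
Proof. by rewrite -splitting_perp -mulmxA perp_adj // mulmx0. Qed.
Lemma adj_splitting : adj T = T.
Proof. by rewrite adjmxZ adj_tracefree // conjc_real. Qed.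
Lemma tr_splitting : \tr T = 0.
Proof. by rewrite mxtraceZ tr_tracefree // mulr0. Qed.
Lemma splitting_sqr : T *m T = Pi.
Proof.
rewrite -scalemxAl -scalemxAr tracefree_sqr // !scalerA rcinv.
rewrite -[disc H q]sqr_sqrtr ?(ltW d0) // rmorphXn /= -/(gap H q).
by rewrite expr2 mulrA mulfVK ?mulVf ?scale1r // gapC_neq0.
Qed.
Lemma compressE : Pi *m H *m Pi = half_tr H q *: Pi + (gap H q)%:C *: T.
Proof. by rewrite gap_splitting addrC subrK. Qed.

Definition proj_pos : 'M[C]_3 := 2%:R^-1 *: (Pi + T).
Definition proj_neg : 'M[C]_3 := 2%:R^-1 *: (Pi - T).
Local Notation P := proj_pos.
Local Notation L := proj_neg.

Lemma half_add (V : lmodType C) (x : V) : 2%:R^-1 *: (x + x) = x.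
Proof.
by rewrite -mulr2n -[x *+ 2]scaler_nat scalerA mulVf ?scale1r // pnatr_eq0.
Qed.

Lemma pos_sub_neg : P - L = T.
Proof. by rewrite -scalerBr opprB addrC addrA subrK half_add. Qed.
Lemma pos_add_neg : P + L = Pi.
Proof. by rewrite -scalerDr addrACA subrr addr0 half_add. Qed.
Lemma pos_neg_line : P + L + Q = 1%:M.
Proof. by rewrite pos_add_neg subrK. Qed.

Lemma posT : P *m T = P.
Proof. by rewrite -scalemxAl mulmxDl splitting_sqr perp_splitting addrC. Qed.
Lemma Tpos : T *m P = P.
Proof. by rewrite -scalemxAr mulmxDr splitting_sqr splitting_perp addrC. Qed.
Lemma negT : L *m T = - L.
Proof. by rewrite -scalemxAl mulmxBl splitting_sqr perp_splitting -(opprB Pi T) scalerN. Qed.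
Lemma Tneg : T *m L = - L.
Proof. by rewrite -scalemxAr mulmxBr splitting_sqr splitting_perp -(opprB Pi T) scalerN. Qed.
Lemma pos_perp : P *m Pi = P.
Proof. by rewrite -scalemxAl mulmxDl (perp_idem q0) splitting_perp. Qed.
Lemma perp_pos : Pi *m P = P.
Proof. by rewrite -scalemxAr mulmxDr (perp_idem q0) perp_splitting. Qed.
Lemma neg_perp : L *m Pi = L.
Proof. by rewrite -scalemxAl mulmxBl (perp_idem q0) splitting_perp. Qed.
Lemma perp_neg : Pi *m L = L.
Proof. by rewrite -scalemxAr mulmxBr (perp_idem q0) perp_splitting. Qed.

Lemma pos_idem : P *m P = P.
Proof. by rewrite {1}/proj_pos -scalemxAl mulmxDl perp_pos Tpos half_add. Qed.
Lemma neg_idem : L *m L = L.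
Proof. by rewrite {1}/proj_neg -scalemxAl mulmxBl perp_neg Tneg opprK half_add. Qed.
Lemma pos_neg : P *m L = 0.
Proof. by rewrite {1}/proj_pos -scalemxAl mulmxDl perp_neg Tneg subrr scaler0. Qed.
Lemma neg_pos : L *m P = 0.
Proof. by rewrite {1}/proj_neg -scalemxAl mulmxBl perp_pos Tpos subrr scaler0. Qed.
Lemma pos_line : P *m Q = 0.
Proof. by rewrite -pos_perp -mulmxA perp_line // mulmx0. Qed.
Lemma line_pos : Q *m P = 0.
Proof. by rewrite -perp_pos mulmxA line_perp // mul0mx. Qed.
Lemma neg_line : L *m Q = 0.
Proof. by rewrite -neg_perp -mulmxA perp_line // mulmx0. Qed.
Lemma line_neg : Q *m L = 0.
Proof. by rewrite -perp_neg mulmxA line_perp // mul0mx. Qed.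

Lemma pos_H (X : 'M[C]_3) : Pi *m X = X ->
  P *m H *m X = (half_tr H q + (gap H q)%:C) *: (P *m X).
Proof.
move=> PX; have -> : P *m H *m X = P *m (Pi *m H *m Pi) *m X.
  by rewrite -!mulmxA PX [P *m (Pi *m _)]mulmxA pos_perp.
rewrite compressE mulmxDr -(scalemxAr (half_tr H q)) -(scalemxAr (gap H q)%:C) posT pos_perp -scalerDl.
by rewrite -scalemxAl.
Qed.
Lemma neg_H (X : 'M[C]_3) : Pi *m X = X ->
  L *m H *m X = (half_tr H q - (gap H q)%:C) *: (L *m X).
Proof.
move=> PX; have -> : L *m H *m X = L *m (Pi *m H *m Pi) *m X.
  by rewrite -!mulmxA PX [L *m (Pi *m _)]mulmxA neg_perp.
rewrite compressE mulmxDr -(scalemxAr (half_tr H q)) -(scalemxAr (gap H q)%:C) negT neg_perp scalerN -scalerBl.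
by rewrite -scalemxAl.
Qed.

(** The idempotents of the splitting satisfy the hypotheses of
    frame_variation_holomorphic, with the eigenvalues of the compression as a and b. *)
Lemma splitting_derivation (i : C) (dP dL dQ dP' dL' dQ' : 'M[C]_3) :
  i * i = -1 ->
  frame_variation P L Q H dP dL dQ -> frame_variation P L Q H dP' dL' dQ' ->
  dQ' = i *: (dQ *m T - T *m dQ) ->
  (dP' - dL') *m Pi = i *: ((dP - dL) *m T).
Proof.
move=> ii D D' EQ; rewrite -pos_add_neg -pos_sub_neg.
pose a := half_tr H q + (gap H q)%:C; pose b := half_tr H q - (gap H q)%:C.
apply: (@frame_variation_holomorphic _ _ P L Q H a b i dP dL dQ dP' dL' dQ').
- exact: pos_neg_line.
- exact: pos_idem.
- exact: neg_idem.
- exact: line_idem.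
- exact: pos_neg.
- exact: neg_pos.
- exact: pos_line.
- exact: line_pos.
- exact: neg_line.
- exact: line_neg.
- by rewrite -!mulmxE (pos_H perp_neg) pos_neg scaler0.
- by rewrite -!mulmxE (neg_H perp_pos) neg_pos scaler0.
- by rewrite -!mulmxE (pos_H perp_pos) pos_idem.
- by rewrite -!mulmxE (neg_H perp_neg) neg_idem.
- rewrite -subr_eq0 /a /b opprB addrC addrA subrK -mulr2n -mulr_natl mulf_eq0 pnatr_eq0 /=.
  exact: gapC_neq0.
- exact: ii.
- exact: D.
- exact: D'.
- by rewrite -!mulmxE pos_sub_neg.
Qed.

End Splitting.

Section Homogeneity.
Variable R : realType.
Local Notation C := R[i].
Variables (H : 'M[C]_3).

Lemma sqnormZ (c : C) (q : 'rV[C]_3) : (sqnorm (c *: q))%:C = `|c| ^+ 2 * (sqnorm q)%:C.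
Proof.
rewrite -!sqnormE /herm adjmxZ -scalemxAl -scalemxAr scalerA [LHS]mxE.
by rewrite sqr_normc.
Qed.

(** All the objects attached to q depend on the point [q] only, because the projector does. *)
Lemma proj_lineZ (c : C) (q : 'rV[C]_3) : c != 0 -> proj_line (c *: q) = proj_line q.
Proof.
move=> c0; have [->|q0] := eqVneq q 0; first by rewrite scaler0.
rewrite /proj_line adjmxZ -scalemxAl -scalemxAr !scalerA; congr (_ *: _).
rewrite !rcinv sqnormZ sqr_normc invfM.
have cc : c^*%C != 0 by rewrite conjc_eq0.
have n0 := sqnormC_neq0 q0.
by rewrite invfM; field; apply/and3P.
Qed.

Lemma tracefreeZ (c : C) (q : 'rV[C]_3) : c != 0 -> tracefree H (c *: q) = tracefree H q.
Proof. by move=> c0; rewrite /tracefree /half_tr /compress /proj_perp proj_lineZ. Qed.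
Lemma discZ (c : C) (q : 'rV[C]_3) : c != 0 -> disc H (c *: q) = disc H q.
Proof. by move=> c0; rewrite /disc tracefreeZ. Qed.
Lemma splittingZ (c : C) (q : 'rV[C]_3) : c != 0 -> splitting H (c *: q) = splitting H q.
Proof. by move=> c0; rewrite /splitting /gap (discZ q c0) (tracefreeZ q c0). Qed.
End Homogeneity.

(** * Calculus of C^n functions on open sets *)

Section Smooth.
Variable R : realType.
Local Notation V := 'rV[R]_4.

(** The increments of f and g at x, hence their first-order remainders, agree near 0. *)
Lemma near_eq_differentiable (W : normedModType R) (f g : V -> W) (x : V) :
  (\near x, f x = g x) -> differentiable f x -> differentiable g x.
Proof.
move=> fg df.
have dfc : continuous ('d f x) by exact: diff_continuous.
have key : g \o shift x = (cst (g x) : V -> W) + ('d f x : V -> W) +o_ (0 : V) (@id V).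
  have /(@eqaddoP R V W V (nbhs_filter_on (0 : V))) ho := diff_locally df.
  apply/(@eqaddoP R V W V (nbhs_filter_on (0 : V))) => e e0; have {}ho := ho e e0.
  have fg0 : \forall h \near (0 : V), f (h + x) = g (h + x).
    by move: fg; rewrite (near_shift 0) /= subr0.
  near=> h.
  have : `|(f \o shift x - (cst (f x) + 'd f x)) h| <= e * `|id h| by near: h.
  rewrite /= /cst !fctE /=.
  by rewrite (near fg0 h) // (nbhs_singleton fg).
apply/diff_locallyP; split.
  by rewrite (diff_unique dfc key).
by rewrite (diff_unique dfc key).
Unshelve. all: by end_near. Qed.

Lemma sqrt_differentiable (f : V -> R) x : differentiable f x -> 0 < f x ->
  differentiable (fun y => Num.sqrt (f y)) x.
Proof.
move=> df f0; apply: (@differentiable_comp _ _ _ _ f Num.sqrt) => //.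
by apply/derivable1_diffP; have [] := is_derive1_sqrt f0.
Qed.

Lemma derive_sqrt_comp (f : V -> R) x v : differentiable f x -> 0 < f x ->
  'D_v (fun y => Num.sqrt (f y)) x = 'D_v f x * (2 * Num.sqrt (f x))^-1.
Proof.
move=> df f0.
have ds : differentiable (Num.sqrt : R -> R) (f x).
  by apply/derivable1_diffP; have [] := is_derive1_sqrt f0.
have -> : 'D_v (fun y => Num.sqrt (f y)) x = 'd (Num.sqrt \o f) x v.
  by rewrite deriveE //; exact: differentiable_comp.
rewrite diff_comp // /= deriveE //.
rewrite diff1E // /= derive1E (@derive_val _ _ _ _ _ _ _ (is_derive1_sqrt f0)).
by [].
Qed.

Section CnTheory.
Variables (D : set V) (oD : open D).

Lemma near_open (x : V) : D x -> \forall y \near x, D y.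
Proof. by move=> Dx; exact: open_nbhs_nbhs. Qed.

Lemma CnS (W : normedModType R) n (f : V -> W) : Cn n.+1 D f -> Cn n D f.
Proof.
elim: n f => [|n IH] f [df Df].
  by move=> x /set_mem Dx; apply: differentiable_continuous; exact: df.
by split=> // v; apply: IH; exact: Df.
Qed.

(** Rules such as the product rule hold at the points of D only; since D is open they can
    nevertheless be substituted under the next derivative. *)
Lemma Cn_ext (W : normedModType R) n (f g : V -> W) :
  (forall x, D x -> f x = g x) -> Cn n D f -> Cn n D g.
Proof.
have nE (f' g' : V -> W) : (forall x, D x -> f' x = g' x) ->
    forall x, D x -> \near x, f' x = g' x.
  by move=> fg x /near_open; apply: filterS => y; exact: fg.
elim: n f g => [|n IH] f g fg.
  move=> cf x /set_mem Dx; have cfx := cf x (mem_set Dx).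
  move: cfx; rewrite /prop_for /continuous_at -fg // => cfx.
  apply: (cvg_trans _ cfx); apply: (@near_eq_cvg _ _ (nbhs x)).
  by apply: filterS (nE _ _ fg _ Dx) => y ->.
move=> [df Df]; split=> [x Dx|v].
  by apply: near_eq_differentiable (df x Dx); exact: nE.
by apply: IH (Df v) => x Dx; apply: near_eq_derive; exact: nE.
Qed.

Lemma smooth_ext (W : normedModType R) (f g : V -> W) :
  (forall x, D x -> f x = g x) -> smooth_on D f -> smooth_on D g.
Proof. by move=> fg sf n; exact: Cn_ext fg (sf n). Qed.

Lemma Cn_cst (W : normedModType R) n (c : W) : Cn n D (fun _ => c).
Proof.
elim: n c => [|n IH] c; first by move=> x _; exact: cst_continuous.
split=> [x _|v]; first exact: differentiable_cst.
by apply: Cn_ext (IH 0) => x _; rewrite derive_cst.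
Qed.

Lemma Cn_add (W : normedModType R) n (f g : V -> W) :
  Cn n D f -> Cn n D g -> Cn n D (fun x => f x + g x).
Proof.
elim: n f g => [|n IH] f g.
  by move=> cf cg x Dx; exact: (cvgD (cf x Dx) (cg x Dx)).
move=> [df Df] [dg Dg]; split=> [x Dx|v].
  by apply: differentiableD; [exact: df | exact: dg].
apply: Cn_ext (IH _ _ (Df v) (Dg v)) => x Dx.
by apply/esym/deriveD; apply: diff_derivable; [exact: df | exact: dg].
Qed.

Lemma Cn_mul n (f g : V -> R) :
  Cn n D f -> Cn n D g -> Cn n D (fun x => f x * g x).
Proof.
elim: n f g => [|n IH] f g.
  by move=> cf cg x Dx; exact: (cvgM (cf x Dx) (cg x Dx)).
move=> fS gS; have [df Df] := fS; have [dg Dg] := gS; split=> [x Dx|v].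
  by apply: differentiableM; [exact: df | exact: dg].
apply: Cn_ext (Cn_add (IH _ _ (CnS fS) (Dg v)) (IH _ _ (CnS gS) (Df v))) => x Dx.
by apply/esym/deriveM; apply: diff_derivable; [exact: df | exact: dg].
Qed.

Lemma Cn_scale (W : normedModType R) n (f : V -> R) (w : W) :
  Cn n D f -> Cn n D (fun x => f x *: w).
Proof.
elim: n f => [|n IH] f.
  by move=> cf x Dx; exact: (cvgZ (cf x Dx) (cvg_cst w)).
move=> [df Df]; split=> [x Dx|v].
  by apply: differentiableZl; exact: df.
apply: Cn_ext (IH _ (Df v)) => x Dx.
rewrite [RHS]deriveE; last by apply: differentiableZl; exact: df.
by rewrite diffZl ?deriveE //; exact: df.
Qed.

Lemma Cn_inv n (f : V -> R) : (forall x, D x -> f x != 0) ->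
  Cn n D f -> Cn n D (fun x => (f x)^-1).
Proof.
move=> f0; elim: n => [|n IH].
  by move=> cf x Dx; exact: (cvgV (f0 _ (set_mem Dx)) (cf x Dx)).
move=> fS; have [df Df] := fS; split=> [x Dx|v].
  by apply: differentiableV; [exact: df | exact: f0].
have If := IH (CnS fS).
apply: Cn_ext (Cn_mul (Cn_cst n (-1 : R)) (Cn_mul (Cn_mul If If) (Df v))) => x Dx.
rewrite (@deriveV _ _ f x v) //; last 2 first.
- exact: f0.
- by apply: diff_derivable; exact: df.
by rewrite mulN1r scaleNr expr2 invfM.
Qed.

Lemma Cn_sqrt n (f : V -> R) : (forall x, D x -> 0 < f x) ->
  Cn n D f -> Cn n D (fun x => Num.sqrt (f x)).
Proof.
move=> f0; elim: n => [|n IH].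
  move=> cf x Dx; apply: (@continuous_comp _ _ _ f Num.sqrt); first exact: (cf x Dx).
  exact: sqrt_continuous.
move=> fS; have [df Df] := fS; split=> [x Dx|v].
  by apply: sqrt_differentiable; [exact: df | exact: f0].
have If := IH (CnS fS).
have s0 x : D x -> 2 * Num.sqrt (f x) != 0.
  by move=> Dx; rewrite mulf_neq0 ?pnatr_eq0 // gt_eqF // sqrtr_gt0 f0.
have I2 := Cn_inv s0 (Cn_mul (Cn_cst n (2 : R)) If).
apply: Cn_ext (Cn_mul (Df v) I2) => x Dx.
by rewrite derive_sqrt_comp //; [exact: df | exact: f0].
Qed.

Lemma Cn_coord n (j : 'I_4) : Cn n D (fun x : V => x 0 j).
Proof.
case: n => [|n]; first by move=> x _; exact: coord_continuous.
split=> [x _|v]; first exact: differentiable_coord.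
apply: Cn_ext (Cn_cst n (v 0 j)) => x _.
have := derive_mx (@derivable_id R V x v).
by rewrite derive_id => /matrixP/(_ 0 j); rewrite mxE.
Qed.

Lemma Cn_sum (W : normedModType R) n (I : Type) (s : seq I) (G : I -> V -> W) :
  (forall i, Cn n D (G i)) -> Cn n D (fun x => \sum_(i <- s) G i x).
Proof.
move=> hG; elim: s => [|i s IH].
  by apply: Cn_ext (Cn_cst n 0) => x _; rewrite big_nil.
by apply: Cn_ext (Cn_add (hG i) IH) => x _; rewrite big_cons.
Qed.

Lemma smooth_mx (m n : nat) (F : V -> 'M[R]_(m, n)) :
  (forall i j, smooth_on D (fun x => F x i j)) -> smooth_on D F.
Proof.
move=> sF k.
apply: Cn_ext (Cn_sum _ (fun i => Cn_sum _ (fun j =>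
  Cn_scale (delta_mx i j) (sF i j k)))) => x _.
exact/esym/matrix_sum_delta.
Qed.

Lemma smooth_entry (m n : nat) (F : V -> 'M[R]_(m, n)) i j :
  smooth_on D F -> smooth_on D (fun x => F x i j).
Proof.
move=> sF k; move: (sF k); elim: k F {sF} => [|k IH] F.
  move=> cF x Dx; apply: (@continuous_comp _ _ _ F (fun M : 'M[R]_(_, _) => M i j)).
    exact: (cF x Dx).
  exact: coord_continuous.
move=> [dF DF]; split=> [x Dx|v].
  apply: (@differentiable_comp _ _ _ _ F (fun M : 'M[R]_(_, _) => M i j : R)).
    exact: dF.
  exact: differentiable_coord.
apply: Cn_ext (IH _ (DF v)) => x Dx.
by rewrite derive_mx ?mxE //; apply: diff_derivable; exact: dF.
Qed.

Lemma smooth_mulmx m n p (F : V -> 'M[R]_(m, n)) (G : V -> 'M[R]_(n, p)) :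
  smooth_on D F -> smooth_on D G -> smooth_on D (fun x => F x *m G x).
Proof.
move=> sF sG; apply: smooth_mx => i j k.
under [X in Cn _ _ X]eq_fun do rewrite mxE.
by apply: Cn_sum => l; apply: Cn_mul; exact: smooth_entry.
Qed.

End CnTheory.
End Smooth.

(** * Complex-valued functions of real variables *)

Section ComplexCalculus.
Variable R : realType.
Local Notation V := 'rV[R]_4.
Local Notation C := R[i].
Local Notation re := (@complex.Re R).
Local Notation im := (@complex.Im R).

Lemma ReM (a b : C) : re (a * b) = re a * re b - im a * im b.
Proof. by case: a => ? ?; case: b. Qed.
Lemma ImM (a b : C) : im (a * b) = re a * im b + im a * re b.
Proof. by case: a => ? ?; case: b => ? ?. Qed.
Lemma ReD (a b : C) : re (a + b) = re a + re b.
Proof. by case: a => ? ?; case: b. Qed.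
Lemma ImD (a b : C) : im (a + b) = im a + im b.
Proof. by case: a => ? ?; case: b => ? ?. Qed.
Lemma ReV (a : C) : re (a^-1) = re a / (re a ^+ 2 + im a ^+ 2).
Proof. by case: a => x y. Qed.
Lemma ImV (a : C) : im (a^-1) = - (im a / (re a ^+ 2 + im a ^+ 2)).
Proof. by case: a => x y. Qed.

(** Complex functions enter through their real and imaginary parts: the variables, the
    derivatives and the notion of smoothness are real. *)
Definition csmooth (D : set V) (f : V -> C) : Prop :=
  smooth_on D (fun x => re (f x)) /\ smooth_on D (fun x => im (f x)).
Definition msmooth (D : set V) m n (F : V -> 'M[C]_(m, n)) : Prop :=
  forall i j, csmooth D (fun x => F x i j).

Definition cderiv (f : V -> C) (x v : V) (d : C) : Prop :=
  is_derive x v (fun y => re (f y)) (re d) /\ is_derive x v (fun y => im (f y)) (im d).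
(** Stated as a relation: derivatives are then computed by rules and identified by
    uniqueness (mderiv_unique). *)
Definition mderiv m n (F : V -> 'M[C]_(m, n)) (x v : V) (dF : 'M[C]_(m, n)) : Prop :=
  forall i j, cderiv (fun y => F y i j) x v (dF i j).

Section SmoothC.
Variables (D : set V) (oD : open D).

Lemma csmooth_ext f g : (forall x, D x -> f x = g x) -> csmooth D f -> csmooth D g.
Proof.
by move=> fg [s1 s2]; split; [apply: smooth_ext s1|apply: smooth_ext s2] => // x Dx;
   rewrite fg.
Qed.
Lemma csmooth_cst c : csmooth D (fun _ => c).
Proof. by split=> n; exact: Cn_cst. Qed.
Lemma csmooth_add f g : csmooth D f -> csmooth D g -> csmooth D (fun x => f x + g x).
Proof.
move=> [f1 f2] [g1 g2]; split.
  by under [X in smooth_on _ X]eq_fun do rewrite ReD; move=> n; exact: Cn_add.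
by under [X in smooth_on _ X]eq_fun do rewrite ImD; move=> n; exact: Cn_add.
Qed.
Lemma csmooth_mul f g : csmooth D f -> csmooth D g -> csmooth D (fun x => f x * g x).
Proof.
move=> [f1 f2] [g1 g2]; split.
  under [X in smooth_on _ X]eq_fun do rewrite ReM -mulN1r.
  move=> n; apply: Cn_add => //; first exact: Cn_mul.
  by apply: (@Cn_mul _ _ oD _ (fun _ => -1)); [exact: (Cn_cst oD)|exact: Cn_mul].
under [X in smooth_on _ X]eq_fun do rewrite ImM.
by move=> n; apply: Cn_add => //; exact: Cn_mul.
Qed.
Lemma csmooth_real (f : V -> R) : smooth_on D f -> csmooth D (fun x => (f x)%:C).
Proof. by move=> sf; split=> //= n; exact: (Cn_cst oD). Qed.
Lemma csmooth_conj f : csmooth D f -> csmooth D (fun x => (f x)^*%C).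
Proof.
move=> [f1 f2]; have E g : (fun x : V => complex.Re ((g x)^*%C)) = (fun x => re (g x)).
  by apply/funext => x; case: (g x).
split; first by rewrite E.
have -> : (fun x => im ((f x)^*%C)) = (fun x => -1 * im (f x)).
  by apply/funext => x; case: (f x) => a b; rewrite mulN1r.
by move=> n; apply: Cn_mul => //; exact: (Cn_cst oD).
Qed.
Lemma csmooth_sum (I : Type) (s : seq I) (G : I -> V -> C) :
  (forall i, csmooth D (G i)) -> csmooth D (fun x => \sum_(i <- s) G i x).
Proof.
move=> hG; elim: s => [|i s IH].
  by apply: csmooth_ext (csmooth_cst 0) => x _; rewrite big_nil.
by apply: csmooth_ext (csmooth_add (hG i) IH) => x _; rewrite big_cons.
Qed.

Lemma msmooth_cst m n (A : 'M[C]_(m, n)) : msmooth D (fun _ => A).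
Proof. by move=> i j; exact: csmooth_cst. Qed.
Lemma msmooth_add m n (F G : V -> 'M[C]_(m, n)) :
  msmooth D F -> msmooth D G -> msmooth D (fun x => F x + G x).
Proof.
move=> sF sG i j; apply: csmooth_ext (csmooth_add (sF i j) (sG i j)) => x _.
by rewrite mxE.
Qed.
Lemma msmooth_scale m n (f : V -> C) (G : V -> 'M[C]_(m, n)) :
  csmooth D f -> msmooth D G -> msmooth D (fun x => f x *: G x).
Proof.
move=> sF sG i j; apply: csmooth_ext (csmooth_mul sF (sG i j)) => x _.
by rewrite mxE.
Qed.
Lemma msmooth_sub m n (F G : V -> 'M[C]_(m, n)) :
  msmooth D F -> msmooth D G -> msmooth D (fun x => F x - G x).
Proof.
move=> sF sG.
have -> : (fun x => F x - G x) = (fun x => F x + (-1) *: G x).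
  by apply/funext => x; rewrite scaleN1r.
by apply: msmooth_add => //; apply: msmooth_scale => //; exact: csmooth_cst.
Qed.
Lemma msmooth_mul m n p (F : V -> 'M[C]_(m, n)) (G : V -> 'M[C]_(n, p)) :
  msmooth D F -> msmooth D G -> msmooth D (fun x => F x *m G x).
Proof.
move=> sF sG i j.
apply: csmooth_ext (csmooth_sum _ (fun k => csmooth_mul (sF i k) (sG k j))) => x _.
by rewrite mxE.
Qed.
Lemma msmooth_adj m n (F : V -> 'M[C]_(m, n)) :
  msmooth D F -> msmooth D (fun x => adj (F x)).
Proof.
move=> sF i j; apply: csmooth_ext (csmooth_conj (sF j i)) => x _.
by rewrite adjmxE.
Qed.
Lemma csmooth_tr n (F : V -> 'M[C]_n) : msmooth D F -> csmooth D (fun x => \tr (F x)).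
Proof. by move=> sF; apply: csmooth_sum => i; exact: sF. Qed.
End SmoothC.

Section Deriv.
Variables (x v : V).

Lemma cderiv_near f g d : (\near x, f x = g x) -> cderiv f x v d -> cderiv g x v d.
Proof.
move=> fg [d1 d2]; split; [apply: near_eq_is_derive d1|apply: near_eq_is_derive d2];
  by apply: filterS fg => y ->.
Qed.
Lemma cderiv_unique f d d' : cderiv f x v d -> cderiv f x v d' -> d = d'.
Proof.
move=> [[_ a] [_ b]] [[_ a'] [_ b']]; move: a a' b b' => -> + -> +.
by case: d d' => ? ? [? ?] /= -> ->.
Qed.
Lemma cderiv_cst c : cderiv (fun _ => c) x v 0.
Proof. by split; exact: is_derive_cst. Qed.
Lemma cderiv_add f g df dg : cderiv f x v df -> cderiv g x v dg ->
  cderiv (fun y => f y + g y) x v (df + dg).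
Proof.
move=> [f1 f2] [g1 g2]; split.
  under [X in is_derive _ _ X _]eq_fun do rewrite ReD.
  by rewrite ReD; exact: is_deriveD.
under [X in is_derive _ _ X _]eq_fun do rewrite ImD.
by rewrite ImD; exact: is_deriveD.
Qed.
Lemma cderiv_mul f g df dg : cderiv f x v df -> cderiv g x v dg ->
  cderiv (fun y => f y * g y) x v (df * g x + f x * dg).
Proof.
move=> [f1 f2] [g1 g2]; split.
  under [X in is_derive _ _ X _]eq_fun do rewrite ReM.
  apply: is_derive_eq; rewrite ReD !ReM /GRing.scale /=; ring.
under [X in is_derive _ _ X _]eq_fun do rewrite ImM.
apply: is_derive_eq; rewrite ImD !ImM /GRing.scale /=; ring.
Qed.
Lemma cderiv_conj f df : cderiv f x v df -> cderiv (fun y => (f y)^*%C) x v (df^*)%C.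
Proof.
move=> [f1 f2]; split.
  have -> : (fun y => re ((f y)^*%C)) = (fun y => re (f y)).
    by apply/funext => y; case: (f y).
  by have -> : re (df^*%C) = re df by case: (df).
have -> : (fun y => im ((f y)^*%C)) = (fun y => - im (f y)).
  by apply/funext => y; case: (f y).
have -> : im (df^*%C) = - im df by case: (df).
exact: is_deriveN.
Qed.
Lemma is_deriveV (f : V -> R) df : f x != 0 -> is_derive x v f df ->
  is_derive x v (fun y => (f y)^-1) (- (df / f x ^+ 2)).
Proof.
move=> f0 [df1 df2]; split; first exact: derivableV.
by rewrite (deriveV f0 df1) df2 scaleNr /GRing.scale /= mulrC.
Qed.
Lemma cderiv_inv f df : f x != 0 -> cderiv f x v df ->
  cderiv (fun y => (f y)^-1) x v (- (df / f x ^+ 2)).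
Proof.
move=> f0 [f1 f2].
pose n2 y := re (f y) * re (f y) + im (f y) * im (f y).
have n0 : n2 x != 0.
  apply: contra_neq f0 => /eqP.
  rewrite /n2 -!expr2 paddr_eq0 ?sqr_ge0 // !sqrf_eq0 => /andP[/eqP a /eqP b].
  by move: a b; case: (f x) => ? ? /= -> ->.
have dn : is_derive x v n2 (re df * re (f x) + re (f x) * re df
   + (im df * im (f x) + im (f x) * im df)).
  by apply: is_derive_eq; rewrite /GRing.scale /=; ring.
have di := is_deriveV n0 dn.
move: n0 di; rewrite /n2; set A := re (f x); set B := im (f x) => n0 di.
have n0' : B ^+ 2 + A ^+ 2 != 0 by rewrite addrC !expr2.
have n1 : (A * A - B * B) ^+ 2 + (A * B + B * A) ^+ 2 != 0.
  rewrite (_ : _ + _ = (A * A + B * B) ^+ 2); last by ring.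
  by rewrite expf_neq0.
have fE : f x = A +i* B by rewrite /A /B; case: (f x).
split.
  have -> : (fun y => re ((f y)^-1)) = (fun y => re (f y)) * (fun y => (n2 y)^-1).
    by apply/funext => y; rewrite ReV !expr2.
  apply: is_derive_eq; rewrite /GRing.scale /= fE expr2.
  case: (df) => a b; rewrite /= -!expr2 /n2 -/A -/B.
  rewrite !expr2 in n1 n0' n0 *.
  by field; apply/andP.
have -> : (fun y => im ((f y)^-1)) = (fun y => - (im (f y) * (n2 y)^-1)).
  by apply/funext => y; rewrite ImV !expr2.
apply: is_derive_eq; rewrite /GRing.scale /= fE expr2.
case: (df) => a b; rewrite /= -!expr2 /n2 -/A -/B.
rewrite !expr2 in n1 n0' n0 *.
by field; apply/andP.
Qed.
Lemma cderiv_sum (I : Type) (s : seq I) (G : I -> V -> C) (dG : I -> C) :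
  (forall i, cderiv (G i) x v (dG i)) ->
  cderiv (fun y => \sum_(i <- s) G i y) x v (\sum_(i <- s) dG i).
Proof.
move=> hG; elim: s => [|i s IH].
  under [X in cderiv X]eq_fun do rewrite big_nil.
  by rewrite big_nil; exact: cderiv_cst.
under [X in cderiv X]eq_fun do rewrite big_cons.
by rewrite big_cons; exact: cderiv_add.
Qed.
Lemma csmooth_deriv D f : csmooth D f -> D x -> exists d, cderiv f x v d.
Proof.
move=> [/(_ 1%N)[s1 _] /(_ 1%N)[s2 _]] Dx.
exists ('D_v (fun y => re (f y)) x +i* 'D_v (fun y => im (f y)) x).
by split; apply/derivableP/diff_derivable; [exact: s1|exact: s2].
Qed.

Lemma mderiv_near m n (F G : V -> 'M[C]_(m, n)) d :
  (\near x, F x = G x) -> mderiv F x v d -> mderiv G x v d.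
Proof.
by move=> FG dF i j; apply: cderiv_near (dF i j); apply: filterS FG => y ->.
Qed.
Lemma mderiv_unique m n (F : V -> 'M[C]_(m, n)) d d' :
  mderiv F x v d -> mderiv F x v d' -> d = d'.
Proof. by move=> h h'; apply/matrixP => i j; exact: cderiv_unique (h i j) (h' i j). Qed.
Lemma mderiv_cst m n (A : 'M[C]_(m, n)) : mderiv (fun _ => A) x v 0.
Proof. by move=> i j; rewrite mxE; exact: cderiv_cst. Qed.
Lemma mderiv_add m n (F G : V -> 'M[C]_(m, n)) dF dG :
  mderiv F x v dF -> mderiv G x v dG -> mderiv (fun y => F y + G y) x v (dF + dG).
Proof.
move=> hF hG i j; under [X in cderiv X]eq_fun do rewrite mxE.
by rewrite mxE; exact: cderiv_add.
Qed.
Lemma mderiv_scale m n f (G : V -> 'M[C]_(m, n)) df dG :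
  cderiv f x v df -> mderiv G x v dG ->
  mderiv (fun y => f y *: G y) x v (df *: G x + f x *: dG).
Proof.
move=> hF hG i j; under [X in cderiv X]eq_fun do rewrite mxE.
by rewrite !mxE; exact: cderiv_mul.
Qed.
Lemma mderiv_opp m n (G : V -> 'M[C]_(m, n)) dG :
  mderiv G x v dG -> mderiv (fun y => - G y) x v (- dG).
Proof.
move=> hG; have := mderiv_scale (cderiv_cst (-1)) hG.
by rewrite scale0r add0r scaleN1r; under [X in mderiv X]eq_fun do rewrite scaleN1r.
Qed.
Lemma mderiv_sub m n (F G : V -> 'M[C]_(m, n)) dF dG :
  mderiv F x v dF -> mderiv G x v dG -> mderiv (fun y => F y - G y) x v (dF - dG).
Proof. by move=> hF hG; apply: mderiv_add => //; exact: mderiv_opp. Qed.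
Lemma mderiv_mul m n p (F : V -> 'M[C]_(m, n)) (G : V -> 'M[C]_(n, p)) dF dG :
  mderiv F x v dF -> mderiv G x v dG ->
  mderiv (fun y => F y *m G y) x v (dF *m G x + F x *m dG).
Proof.
move=> hF hG i j; under [X in cderiv X]eq_fun do rewrite mxE.
rewrite !mxE -big_split /=; apply: cderiv_sum => k; exact: cderiv_mul.
Qed.
Lemma mderiv_adj m n (F : V -> 'M[C]_(m, n)) dF :
  mderiv F x v dF -> mderiv (fun y => adj (F y)) x v (adj dF).
Proof.
move=> hF i j; under [X in cderiv X]eq_fun do rewrite adjmxE.
by rewrite adjmxE; exact: cderiv_conj.
Qed.
Lemma msmooth_deriv D m n (F : V -> 'M[C]_(m, n)) :
  msmooth D F -> D x -> exists d, mderiv F x v d.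
Proof.
move=> sF Dx.
exists (\matrix_(i, j) sval (cid (csmooth_deriv (sF i j) Dx))) => i j.
by rewrite mxE; case: cid.
Qed.
End Deriv.

End ComplexCalculus.

(** * Affine charts and the almost complex structure *)

Section Charts.
Variable R : realType.
Local Notation V := 'rV[R]_4.
Local Notation C := R[i].
Local Notation re := (@complex.Re R).
Local Notation im := (@complex.Im R).

Lemma split_ord4 (j : 'I_4) : exists m : 'I_2, j = @lshift 2 2 m \/ j = @rshift 2 2 m.
Proof. by case: (@splitP 2 2 j) => m jm; exists m; [left|right]; exact/val_inj. Qed.

Definition real_row (z : 'rV[C]_2) : V :=
  @row_mx R 1 2 2 (\row_m re (z 0 m)) (\row_m im (z 0 m)).

Lemma zvecK : cancel (@zvec R) real_row.
Proof.
move=> x; apply/rowP => j; rewrite /real_row.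
have [m [->|->]] := split_ord4 j.
  by rewrite (@row_mxEl R 1 2 2) !mxE.
by rewrite (@row_mxEr R 1 2 2) !mxE.
Qed.
Lemma real_rowK : cancel real_row (@zvec R).
Proof.
move=> z; apply/rowP => m; rewrite mxE /real_row (@row_mxEl R 1 2 2) (@row_mxEr R 1 2 2) !mxE.
by case: (z 0 m).
Qed.
Lemma zvec_inj : injective (@zvec R).
Proof. exact: can_inj zvecK. Qed.
Lemma zvecD x y : zvec (x + y) = zvec x + zvec y :> 'rV[C]_2.
Proof. by apply/rowP => m; rewrite !mxE. Qed.
Lemma zvecN x : zvec (- x) = - zvec x :> 'rV[C]_2.
Proof. by apply/rowP => m; rewrite !mxE. Qed.
Lemma zvecB x y : zvec (x - y) = zvec x - zvec y :> 'rV[C]_2.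
Proof. by rewrite zvecD zvecN. Qed.
Lemma zvecZ (s : R) x : zvec (s *: x) = s%:C *: zvec x :> 'rV[C]_2.
Proof.
apply/rowP => m; rewrite !mxE; apply/eqP; rewrite eq_complex /=.
by rewrite !mul0r subr0 addr0 !eqxx.
Qed.
Lemma zvec0 : zvec 0 = 0 :> 'rV[C]_2.
Proof. by apply/rowP => m; rewrite !mxE. Qed.

(** The matrix of z |-> z M in the real coordinates (Re z, Im z). *)
Definition realify (M : 'M[C]_2) : 'M[R]_4 :=
  @block_mx R 2 2 2 2 (map_mx re M) (map_mx im M) (- map_mx im M) (map_mx re M).

Lemma zvec_row (a b : 'rV[R]_2) :
  zvec (@row_mx R 1 2 2 a b) = \row_m (a 0 m +i* b 0 m).
Proof. by apply/rowP => m; rewrite [LHS]mxE [RHS]mxE (@row_mxEl R 1 2 2) (@row_mxEr R 1 2 2). Qed.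

Lemma zvec_mul (X : V) (M : 'M[C]_2) : zvec (X *m realify M) = zvec X *m M.
Proof.
rewrite -[X](@hsubmxK R 1 2 2) /realify (@mul_row_block R 1 2 2 2 2) !zvec_row.
apply/rowP => m; rewrite !(mxE, big_ord_recl, big_ord0).
case: (M _ _) => a b; case: (M _ _) => c d.
by apply/eqP; rewrite eq_complex /=; apply/andP; split; apply/eqP; ring.
Qed.

Lemma eq_realify (A B : 'M[R]_4) : (forall X, zvec (X *m A) = zvec (X *m B)) -> A = B.
Proof.
move=> h; apply/row_matrixP => j; rewrite !rowE.
exact: zvec_inj.
Qed.

Definition inc (k : 'I_3) : 'M[C]_(2, 3) := \matrix_(m, j) (j == lift k m)%:R.
Definition ecol (k : 'I_3) : 'cV[C]_3 := delta_mx k 0.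
Definition erow (k : 'I_3) : 'rV[C]_3 := delta_mx 0 k.

Lemma insertE a k z : insert a k z = a *: erow k + z *m inc k.
Proof.
apply/rowP => j; rewrite !mxE; case: unliftP => [m ->|->] /=.
  rewrite (bigD1 m) //= big1 ?mxE => [|m' m'm]; rewrite ?mxE.
    by rewrite eqxx mulr1 addr0 eq_sym (negbTE (neq_lift _ _)) mulr0 add0r.
  by rewrite (inj_eq lift_inj) eq_sym (negbTE m'm) mulr0.
rewrite eqxx mulr1 big1 ?addr0 // => m _.
by rewrite !mxE (negbTE (neq_lift _ _)) mulr0.
Qed.
Lemma chart_vecE k x : chart_vec k x = erow k + zvec x *m inc k.
Proof. by rewrite /chart_vec insertE scale1r. Qed.
Lemma dchart_vecE k x : dchart_vec k x = zvec x *m inc k.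
Proof. by rewrite /dchart_vec insertE scale0r add0r. Qed.

Lemma mul_ecol k (v : 'rV[C]_3) : v *m ecol k = (v 0 k)%:M.
Proof. by rewrite [LHS]mx11_scalar; congr (_%:M); rewrite -colE mxE. Qed.
Lemma inc_tr k : inc k *m (inc k)^T = 1%:M.
Proof.
apply/matrixP => m n; rewrite !mxE (bigD1 (lift k m)) //= big1 => [|j jm].
  by rewrite !mxE eqxx mul1r addr0 (inj_eq lift_inj).
by rewrite !mxE (negbTE jm) mul0r.
Qed.
Lemma inc_ecol k : inc k *m ecol k = 0.
Proof.
apply/matrixP => m n; rewrite !mxE big1 // => j _; rewrite !mxE.
have [->|_] := eqVneq j k; last by rewrite mulr0.
by rewrite (negbTE (neq_lift _ _)) mul0r.
Qed.
Lemma erow_inc k : erow k *m (inc k)^T = 0.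
Proof. by apply: trmx_inj; rewrite trmx_mul trmxK trmx_delta inc_ecol trmx0. Qed.
Lemma erow_ecol k : erow k *m ecol k = 1%:M.
Proof. by rewrite mul_delta_mx; apply/matrixP => i j; rewrite !mxE !ord1. Qed.
Lemma tr_inc k : (inc k)^T *m inc k = 1%:M - ecol k *m erow k.
Proof.
rewrite mul_delta_mx; apply/matrixP => i j; rewrite !mxE.
case: (unliftP k i) => [m ->|->].
  rewrite (bigD1 m) //= big1 => [|m' m'm]; rewrite !mxE.
    by rewrite eqxx mul1r addr0 [lift k m == k]eq_sym (negbTE (neq_lift _ _)) /= subr0 eq_sym.
  by rewrite (inj_eq lift_inj) eq_sym (negbTE m'm) mul0r.
rewrite big1 ?eqxx /= => [|m _]; first by rewrite eq_sym subrr.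
by rewrite !mxE (negbTE (neq_lift _ _)) mul0r.
Qed.

(** The differential at the point q of chart k of the affine coordinates v_j / v_k, that is,
    the quotient map from C^3 to C^3 / q read in the chart (q has k-th coordinate 1). *)
Definition aff (k : 'I_3) (x : V) : 'M[C]_(3, 2) := (inc k)^T - ecol k *m zvec x.

Lemma inc_aff k x : inc k *m aff k x = 1%:M.
Proof. by rewrite mulmxBr inc_tr mulmxA inc_ecol mul0mx subr0. Qed.
Lemma chart_aff k x : chart_vec k x *m aff k x = 0.
Proof.
rewrite chart_vecE mulmxDl -mulmxA inc_aff mulmx1 mulmxBr erow_inc mulmxA erow_ecol.
by rewrite mul1mx sub0r addNr.
Qed.
Lemma aff_inc k x : aff k x *m inc k = 1%:M - ecol k *m chart_vec k x.
Proof. by rewrite mulmxBl tr_inc chart_vecE mulmxDr mulmxA opprD addrA. Qed.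

(** In C^3 / q, which is the tangent space, the structure is v |-> i v T with T the
    splitting: the standard complex structure on one eigenline, its conjugate on the other.
    Since T commutes with i it is a complex 2 x 2 matrix in the chart. *)
Definition jmx (H : 'M[C]_3) (k : 'I_3) (x : V) : 'M[C]_2 :=
  'i *: (inc k *m splitting H (chart_vec k x) *m aff k x).
Definition jfield (H : 'M[C]_3) : endo_field R := fun k x => realify (jmx H k x).

End Charts.

(** * Smoothness of the structure *)

Section ChartCalculus.
Variable R : realType.
Local Notation V := 'rV[R]_4.
Local Notation C := R[i].
Local Notation re := (@complex.Re R).
Local Notation im := (@complex.Im R).

Lemma is_derive_mxP m n (F : V -> 'M[R]_(m, n)) (x v : V) dF :
  is_derive x v F dF <-> forall i j, is_derive x v (fun y => F y i j) (dF i j).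
Proof.
split=> [[d <-] i j|h].
  by split; [exact: ((derivable_mxP F x v).1 d i j) | rewrite derive_mx // mxE].
have d : derivable F x v by apply/derivable_mxP => i j; have [] := h i j.
split=> //; apply/matrixP => i j; rewrite derive_mx // mxE.
by have [_ ->] := h i j.
Qed.

Lemma mderiv_zvec (Y : V -> V) (x v dY : V) :
  is_derive x v Y dY <-> mderiv (fun y => zvec (Y y)) x v (zvec dY).
Proof.
split=> [/is_derive_mxP h i j|h].
  by split; under [X in is_derive _ _ X _]eq_fun do rewrite mxE; rewrite mxE /=; exact: h.
apply/is_derive_mxP => i j; rewrite (ord1 i) {i}.
have [m [->|->]] := split_ord4 j.
- have [+ _] := h 0 m; rewrite mxE /=.
  by under [X in is_derive _ _ X _]eq_fun do rewrite mxE.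
- have [_] := h 0 m; rewrite mxE /=.
  by under [X in is_derive _ _ X _]eq_fun do rewrite mxE.
Qed.

Lemma mderiv_id (x v : V) : mderiv (@zvec R) x v (zvec v).
Proof. by apply: ((mderiv_zvec id x v v).1 _); exact: is_derive_id. Qed.

Lemma mderiv_chart k (x v : V) : mderiv (chart_vec k) x v (dchart_vec k v).
Proof.
have := mderiv_add (mderiv_cst x v (erow R k))
  (mderiv_mul (mderiv_id x v) (mderiv_cst x v (inc R k))).
rewrite mulmx0 addr0 add0r dchart_vecE.
by under [X in mderiv X]eq_fun do rewrite -chart_vecE.
Qed.

Lemma mderiv_aff k (x v : V) : mderiv (aff k) x v (- (ecol R k *m zvec v)).
Proof.
have := mderiv_sub (mderiv_cst x v ((inc R k)^T))
  (mderiv_mul (mderiv_cst x v (ecol R k)) (mderiv_id x v)).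
by rewrite mul0mx !add0r.
Qed.

Section Smoothness.
Variables (D : set V) (oD : open D).

Lemma msmooth_zvec : msmooth D (@zvec R).
Proof.
move=> i j; split; under [X in smooth_on _ X]eq_fun do rewrite mxE;
  by move=> n; exact: Cn_coord.
Qed.
Lemma msmooth_chart k : msmooth D (chart_vec k).
Proof.
have -> : @chart_vec R k = (fun x => erow R k + zvec x *m inc R k).
  by apply/funext => x; rewrite chart_vecE.
by apply: msmooth_add => //; [exact: msmooth_cst | apply: msmooth_mul => //;
  [exact: msmooth_zvec | exact: msmooth_cst]].
Qed.
Lemma msmooth_aff k : msmooth D (aff k).
Proof.
by apply: msmooth_sub => //; [exact: msmooth_cst | apply: msmooth_mul => //;
  [exact: msmooth_cst | exact: msmooth_zvec]].
Qed.

Variable H : 'M[C]_3.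

Lemma smooth_sqnorm k : smooth_on D (fun x => sqnorm (chart_vec k x)).
Proof.
have := msmooth_mul oD (@msmooth_chart k) (msmooth_adj oD (@msmooth_chart k)).
by move/(_ 0 0) => [].
Qed.

Lemma msmooth_line k : msmooth D (fun x => proj_line (chart_vec k x)).
Proof.
apply: msmooth_scale => //.
  apply: csmooth_real => // n; apply: Cn_inv => //; last exact: smooth_sqnorm.
  by move=> x _; rewrite gt_eqF // sqnorm_gt0 // chart_vec_neq0.
by apply: msmooth_mul => //; [apply: msmooth_adj => //|]; exact: msmooth_chart.
Qed.

Lemma msmooth_perp k : msmooth D (fun x => proj_perp (chart_vec k x)).
Proof. by apply: msmooth_sub => //; [exact: msmooth_cst | exact: msmooth_line]. Qed.

Lemma msmooth_compress k : msmooth D (fun x => compress H (chart_vec k x)).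
Proof.
apply: msmooth_mul => //; last exact: msmooth_perp.
apply: msmooth_mul => //; first exact: msmooth_perp.
exact: msmooth_cst.
Qed.

Lemma msmooth_tracefree k : msmooth D (fun x => tracefree H (chart_vec k x)).
Proof.
apply: msmooth_sub => //; first exact: msmooth_compress.
apply: msmooth_scale => //; last exact: msmooth_perp.
apply: csmooth_mul => //; last exact: csmooth_cst.
apply: csmooth_tr => //; exact: msmooth_compress.
Qed.

Lemma smooth_disc k : smooth_on D (fun x => disc H (chart_vec k x)).
Proof.
move=> n; apply: Cn_mul => //; last exact: Cn_cst.
have := csmooth_tr oD (msmooth_mul oD (@msmooth_tracefree k) (@msmooth_tracefree k)).
by case.
Qed.

Lemma msmooth_splitting k : (forall x, D x -> 0 < disc H (chart_vec k x)) ->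
  msmooth D (fun x => splitting H (chart_vec k x)).
Proof.
move=> d0; apply: msmooth_scale => //; last exact: msmooth_tracefree.
apply: csmooth_real => // n; apply: Cn_inv => //.
  by move=> x Dx; rewrite gt_eqF // sqrtr_gt0 d0.
by apply: Cn_sqrt => //; exact: smooth_disc.
Qed.

Lemma msmooth_jmx k : (forall x, D x -> 0 < disc H (chart_vec k x)) ->
  msmooth D (jmx H k).
Proof.
move=> d0; apply: msmooth_scale => //; first exact: csmooth_cst.
apply: msmooth_mul => //; last exact: msmooth_aff.
apply: msmooth_mul => //; first exact: msmooth_cst.
exact: msmooth_splitting.
Qed.

Lemma smooth_realify (F : V -> 'M[C]_2) : msmooth D F -> smooth_on D (fun x => realify (F x)).
Proof.
move=> sF; apply: smooth_mx => // i j.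
have [m [->|->]] := split_ord4 i.
- have [n [->|->]] := split_ord4 j.
  + under [X in smooth_on _ X]eq_fun do rewrite (@block_mxEul R 2 2 2 2) mxE.
    by have [] := sF m n.
  + under [X in smooth_on _ X]eq_fun do rewrite (@block_mxEur R 2 2 2 2) mxE.
    by have [] := sF m n.
- have [n [->|->]] := split_ord4 j.
  + under [X in smooth_on _ X]eq_fun do rewrite (@block_mxEdl R 2 2 2 2) mxE mxE -mulN1r.
    move=> p; apply: Cn_mul => //; first exact: (Cn_cst oD).
    by have [_ ] := sF m n.
  + under [X in smooth_on _ X]eq_fun do rewrite (@block_mxEdr R 2 2 2 2) mxE.
    by have [] := sF m n.
Qed.

Lemma smooth_real_row (F : V -> 'rV[C]_2) :
  msmooth D F -> smooth_on D (fun x => real_row (F x)).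
Proof.
move=> sF; apply: smooth_mx => // i j; rewrite (ord1 i).
have [m [->|->]] := split_ord4 j.
- under [X in smooth_on _ X]eq_fun do rewrite /real_row (@row_mxEl R 1 2 2) mxE.
  by have [] := sF 0 m.
- under [X in smooth_on _ X]eq_fun do rewrite /real_row (@row_mxEr R 1 2 2) mxE.
  by have [] := sF 0 m.
Qed.

End Smoothness.
End ChartCalculus.

(** * The Cauchy-Riemann equation *)

(** Variation of the projector onto q along i u T compared with that along u. *)
Lemma line_variation (R : realType) (u q : 'rV[R[i]]_3) (T Pi : 'M[R[i]]_3) :
  q *m T = 0 -> T *m adj q = 0 -> Pi *m T = T -> T *m Pi = T ->
  adj T = T -> adj Pi = Pi ->
  adj q *m ('i *: (u *m T)) + adj ('i *: (u *m T)) *m q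
  = 'i *: ((adj q *m (u *m Pi) + adj (u *m Pi) *m q) *m T
           - T *m (adj q *m (u *m Pi) + adj (u *m Pi) *m q)).
Proof.
move=> qT Tq PT TP aT aP.
rewrite mulmxDl mulmxDr !adjmxM aP -!mulmxA PT qT !mulmx0 addr0.
rewrite [T *m (adj _ *m _)]mulmxA Tq mul0mx add0r [T *m (Pi *m _)]mulmxA TP.
rewrite adjmxZ adjmxM aT -scalemxAl -scalemxAr scalerBr -mulmxA; congr (_ + _).
have -> : ('i)^*%C = - 'i :> R[i] by apply/eqP; rewrite eq_complex /= oppr0 !eqxx.
by rewrite scaleNr.
Qed.

Section CauchyRiemann.
Variable R : realType.
Local Notation V := 'rV[R]_4.
Local Notation C := R[i].
Variables (H : 'M[C]_3) (HH : adj H = H) (k : 'I_3).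
Local Notation q := (chart_vec k).
Let D := [set x : V | 0 < disc H (q x)].

Lemma open_disc_pos : open D.
Proof.
have cd : continuous (fun x : V => disc H (q x)).
  by move=> x; apply: (@smooth_disc R setT openT H k 0%N); rewrite inE.
exact: (open_comp (fun x _ => cd x) (@open_gt R 0)).
Qed.

Local Notation Qf := (fun y : V => proj_line (q y)).
Local Notation Pf := (fun y : V => proj_perp (q y)).
Local Notation Tf := (fun y : V => splitting H (q y)).

Section AtPoint.
Variables (x : V) (Dx : D x).
Let q0 (y : V) : q y != 0. Proof. exact: chart_vec_neq0. Qed.
Let e0 : 0 < disc H (q x). Proof. exact: Dx. Qed.

Lemma near_disc_pos (P : V -> Prop) : (forall y, D y -> P y) -> \near x, P x.
Proof. by move=> h; apply: filterS (near_open open_disc_pos Dx) => y; exact: h. Qed.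

Lemma mderiv_line_chart (v : V) dQ : mderiv Qf x v dQ ->
  q x *m dQ = dchart_vec k v *m proj_perp (q x).
Proof.
move=> hQ; have h := mderiv_mul (mderiv_chart k x v) hQ.
have h' : mderiv (fun y => q y *m proj_line (q y)) x v (dchart_vec k v).
  under [X in mderiv X]eq_fun do rewrite (mul_line (q0 _)).
  exact: mderiv_chart.
have e := mderiv_unique h' h.
by rewrite /proj_perp mulmxBr mulmx1 {1}e addrAC subrr add0r.
Qed.

(** Differentiating q = q Q gives q dQ, hence the (Q, perp) block of dQ; the other
    off-diagonal block is its adjoint, and an idempotent has no diagonal variation. *)
Lemma mderiv_lineE (v : V) dQ : mderiv Qf x v dQ ->
  dQ = (sqnorm (q x))^-1%:C *: (adj (q x) *m (dchart_vec k v *m proj_perp (q x))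
       + adj (dchart_vec k v *m proj_perp (q x)) *m q x).
Proof.
move=> hQ; have hu := mderiv_line_chart hQ; rewrite -hu.
have adQ : adj dQ = dQ.
  have h := mderiv_adj hQ.
  have h' : mderiv (fun y => adj (proj_line (q y))) x v dQ.
    by under [X in mderiv X]eq_fun do rewrite adj_line.
  exact: mderiv_unique h h'.
have QQ : dQ = dQ *m proj_line (q x) + proj_line (q x) *m dQ.
  have h := mderiv_mul hQ hQ.
  have h' : mderiv (fun y => proj_line (q y) *m proj_line (q y)) x v dQ.
    by under [X in mderiv X]eq_fun do rewrite (line_idem (q0 _)).
  exact: mderiv_unique h' h.
rewrite {1}QQ /proj_line -scalemxAr -scalemxAl -scalerDr; congr (_ *: _).
by rewrite adjmxM adQ addrC !mulmxA.
Qed.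

(** The relations between the three projectors hold where disc is positive, which is an
    open condition, so they may be differentiated. *)
Lemma frame_variation_chart (v : V) dQ dT : mderiv Qf x v dQ -> mderiv Tf x v dT ->
  frame_variation (proj_pos H (q x)) (proj_neg H (q x)) (proj_line (q x)) H
    (2%:R^-1 *: (- dQ + dT)) (2%:R^-1 *: (- dQ - dT)) dQ.
Proof.
move=> hQ hT.
have hc (c : C) : cderiv (fun _ : V => c) x v 0 by exact: cderiv_cst.
have hPi : mderiv Pf x v (- dQ).
  by have := mderiv_sub (mderiv_cst x v (1%:M : 'M[C]_3)) hQ; rewrite sub0r.
have hP : mderiv (fun y => proj_pos H (q y)) x v (2%:R^-1 *: (- dQ + dT)).
  by have := mderiv_scale (hc 2%:R^-1) (mderiv_add hPi hT); rewrite scale0r add0r.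
have hL : mderiv (fun y => proj_neg H (q y)) x v (2%:R^-1 *: (- dQ - dT)).
  by have := mderiv_scale (hc 2%:R^-1) (mderiv_sub hPi hT); rewrite scale0r add0r.
have rel (F G K : V -> 'M[C]_3) dF dG dK : mderiv F x v dF -> mderiv G x v dG ->
    mderiv K x v dK -> (forall y, D y -> F y *m G y = K y) ->
    dF *m G x + F x *m dG = dK.
  move=> hF hG hK e; apply: mderiv_unique (mderiv_mul hF hG) _.
  by apply: mderiv_near hK; apply: near_disc_pos => y Dy; rewrite e.
have h0 : mderiv (fun _ : V => 0 : 'M[C]_3) x v 0 by exact: mderiv_cst.
have hH : mderiv (fun _ : V => H) x v 0 by exact: mderiv_cst.
have rel0 (F G : V -> 'M[C]_3) dF dG : mderiv F x v dF -> mderiv G x v dG ->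
    (forall y, D y -> F y *m H *m G y = 0) ->
    dF *m H *m G x + F x *m H *m dG = 0.
  move=> hF hG e; rewrite -(rel _ _ _ _ _ _ (mderiv_mul hF hH) hG h0) //.
  by rewrite mulmx0 addr0.
split; split; rewrite -!mulmxE.
- by apply: (rel _ _ _ _ _ _ hP hP hP) => y Dy; exact: pos_idem.
- by apply: (rel _ _ _ _ _ _ hL hL hL) => y Dy; exact: neg_idem.
- by apply: (rel _ _ _ _ _ _ hP hL h0) => y Dy; exact: pos_neg.
- by apply: (rel _ _ _ _ _ _ hL hP h0) => y Dy; exact: neg_pos.
- by apply: (rel _ _ _ _ _ _ hP hQ h0) => y Dy; exact: pos_line.
- by apply: (rel _ _ _ _ _ _ hL hQ h0) => y Dy; exact: neg_line.
- by apply: (rel _ _ _ _ _ _ hQ hP h0) => y Dy; exact: line_pos.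
- by apply: (rel _ _ _ _ _ _ hQ hL h0) => y Dy; exact: line_neg.
- apply: (rel0 _ _ _ _ hP hL) => y Dy.
  by rewrite pos_H ?perp_neg ?pos_neg ?scaler0.
- apply: (rel0 _ _ _ _ hL hP) => y Dy.
  by rewrite neg_H ?perp_pos ?neg_pos ?scaler0.
Qed.

Lemma dchart_jfield (v : V) :
  dchart_vec k (v *m jfield H k x) =
  'i *: (dchart_vec k v *m splitting H (q x) *m (1%:M - ecol R k *m q x)).
Proof.
rewrite !dchart_vecE zvec_mul -aff_inc /jmx -scalemxAr -scalemxAl !mulmxA.
by [].
Qed.

Lemma dchart_jfield_perp (v : V) :
  dchart_vec k (v *m jfield H k x) *m proj_perp (q x) =
  'i *: (dchart_vec k v *m splitting H (q x)).
Proof.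
rewrite dchart_jfield -scalemxAl -mulmxA mulmxBl mul1mx -[ecol R k *m _ *m _]mulmxA.
by rewrite (mul_perp (q0 x)) mulmx0 subr0 -mulmxA splitting_perp.
Qed.

(** Modulo the line of q, the splitting is a holomorphic function of q for the structure that
    it defines. *)
Lemma splitting_cauchy_riemann (v : V) dT dT' :
  mderiv Tf x v dT -> mderiv Tf x (v *m jfield H k x) dT' ->
  dT' *m proj_perp (q x) = 'i *: (dT *m splitting H (q x)).
Proof.
move=> hT hT'.
have [dQ hQ] := msmooth_deriv v (@msmooth_line R D open_disc_pos k) Dx.
have [dQ' hQ'] := msmooth_deriv (v *m jfield H k x) (@msmooth_line R D open_disc_pos k) Dx.
have sub (a b : 'M[C]_3) : 2%:R^-1 *: (- a + b) - 2%:R^-1 *: (- a - b) = b.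
  by rewrite -scalerBr opprD !opprK addrACA addNr add0r half_add.
rewrite -(sub dQ dT) -(sub dQ' dT').
apply: (splitting_derivation (q0 x) HH e0 _ (frame_variation_chart hQ hT) (frame_variation_chart hQ' hT')).
  by rewrite -expr2 sqr_i.
rewrite (mderiv_lineE hQ) (mderiv_lineE hQ') dchart_jfield_perp.
set u := dchart_vec k v.
rewrite -scalemxAl -[splitting H (q x) *m (_ *: _)]scalemxAr -scalerBr.
rewrite scalerA ['i * _]mulrC -scalerA; congr (_ *: _).
apply: line_variation.
- exact: mul_splitting.
- exact: splitting_adj.
- exact: perp_splitting.
- exact: splitting_perp.
- exact: adj_splitting.
- exact: adj_perp.
Qed.

End AtPoint.
End CauchyRiemann.

(** * Compatibility with the metric and the charts *)

Section OcsFields.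
Variable R : realType.
Local Notation V := 'rV[R]_4.
Local Notation C := R[i].
Variables (H : 'M[C]_3) (HH : adj H = H).
Local Notation re := (@complex.Re R).
Local Notation T k x := (splitting H (chart_vec k x)).

Lemma zvec_jfield k (x v : V) : zvec (v *m jfield H k x) = zvec v *m jmx H k x.
Proof. exact: zvec_mul. Qed.

Section AtPoint.
Variables (k : 'I_3) (x : V) (Dx : 0 < disc H (chart_vec k x)).
Local Notation q := (chart_vec k x).
Let q0 : q != 0. Proof. exact: chart_vec_neq0. Qed.

Lemma line_aff : proj_line q *m aff k x = 0.
Proof. by rewrite -scalemxAl -mulmxA chart_aff mulmx0 scaler0. Qed.

Lemma perp_aff : proj_perp q *m aff k x = aff k x.
Proof. by rewrite mulmxBl mul1mx line_aff subr0. Qed.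

Lemma aff_jmx : aff k x *m jmx H k x = 'i *: (T k x *m aff k x).
Proof.
rewrite -scalemxAr !mulmxA aff_inc mulmxBl mul1mx -[ecol R k *m _ *m _]mulmxA.
by rewrite (mul_splitting H q0) mulmx0 subr0.
Qed.

Lemma jmx_sqr : jmx H k x *m jmx H k x = - 1%:M.
Proof.
rewrite {1}/jmx -scalemxAl -mulmxA aff_jmx -(scalemxAr 'i) scalerA -expr2 sqr_i.
rewrite -!mulmxA [T k x *m (T k x *m _)]mulmxA (splitting_sqr q0 HH Dx) perp_aff.
by rewrite inc_aff scaleN1r.
Qed.

(** The chart matrix inherits the Cauchy-Riemann equation from the splitting: the variation
    of the quotient map aff contributes the same term to both sides. *)
Lemma jmx_cauchy_riemann (v : V) dM dM' :
  mderiv (jmx H k) x v dM -> mderiv (jmx H k) x (v *m jfield H k x) dM' ->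
  dM' = dM *m jmx H k x.
Proof.
move=> hM hM'.
have sT := @msmooth_splitting R _ (@open_disc_pos R H k) H k (fun _ h => h).
have [dT hT] := msmooth_deriv v sT Dx.
have [dT' hT'] := msmooth_deriv (v *m jfield H k x) sT Dx.
have dME p dS dN : mderiv (fun y : V => T k y) x p dS -> mderiv (jmx H k) x p dN ->
    dN = 'i *: (inc R k *m dS *m aff k x - inc R k *m T k x *m ecol R k *m zvec p).
  move=> hS hN.
  have h := mderiv_scale (cderiv_cst x p 'i)
    (mderiv_mul (mderiv_mul (mderiv_cst x p (inc R k)) hS) (mderiv_aff k x p)).
  rewrite (mderiv_unique hN h) scale0r add0r mul0mx add0r mulmxN.
  by rewrite !mulmxA.
rewrite (dME _ _ _ hT hM) (dME _ _ _ hT' hM') zvec_jfield -scalemxAl; congr (_ *: _).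
rewrite mulmxBl !mulmxA; congr (_ - _).
rewrite -!mulmxA aff_jmx -scalemxAr -[in LHS]perp_aff [dT' *m _]mulmxA.
rewrite (splitting_cauchy_riemann HH Dx hT hT') -scalemxAl -mulmxA.
by [].
Qed.

End AtPoint.

(** The Fubini-Study form is the Hermitian form of the components orthogonal to the point. *)
Lemma fubini_studyE k (x X Y : V) :
  fubini_study k x X Y = re ((sqnorm (chart_vec k x))^-1%:C *
    (dchart_vec k X *m proj_perp (chart_vec k x) *m adj (dchart_vec k Y)) 0 0).
Proof.
rewrite /fubini_study; set q := chart_vec k x; set u := dchart_vec k X; set w := dchart_vec k Y.
congr re.
have -> : u *m proj_perp q *m adj w = u *m adj w - (sqnorm q)^-1%:C *: (u *m adj q *m (q *m adj w)).
  by rewrite mulmxBr mulmx1 mulmxBl -scalemxAr -scalemxAl !mulmxA.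
rewrite !hermE -scalar_mxM !mxE eqxx !mulr1n sqnormE rcinv.
have n0 : (sqnorm q)%:C != 0 by apply: sqnormC_neq0; exact: chart_vec_neq0.
by field.
Qed.

(** On the orthogonal plane the structure is i T with T a Hermitian involution, hence unitary. *)
Lemma jfield_orthogonal k (x X Y : V) : 0 < disc H (chart_vec k x) ->
  fubini_study k x (X *m jfield H k x) (Y *m jfield H k x) = fubini_study k x X Y.
Proof.
move=> Dx; rewrite !fubini_studyE; congr (re (_ * _)).
have q0 : chart_vec k x != 0 by exact: chart_vec_neq0.
have PP (u w : 'rV[C]_3) : u *m proj_perp (chart_vec k x) *m adj w =
    (u *m proj_perp (chart_vec k x)) *m adj (w *m proj_perp (chart_vec k x)).
  by rewrite adjmxM (adj_perp) !mulmxA -[u *m _ *m proj_perp _]mulmxA perp_idem.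
rewrite PP !dchart_jfield_perp // adjmxZ adjmxM adj_splitting // -scalemxAl -scalemxAr scalerA.
have -> : 'i * ('i)^*%C = 1 :> C.
  by apply/eqP; rewrite eq_complex /=; apply/andP; split; apply/eqP; ring.
rewrite scale1r !mulmxA -[_ *m T k x *m T k x]mulmxA splitting_sqr //.
Qed.

Section Transition.
Variables (a b : 'I_3) (x : V).
Local Notation v := (chart_vec a x).
Hypothesis (vb : v 0 b != 0).

Lemma zvec_transition y : zvec (transition a b y) =
  (chart_vec a y 0 b)^-1 *: (chart_vec a y *m (inc R b)^T).
Proof.
have -> : transition a b y =
    real_row (\row_m (chart_vec a y 0 (lift b m) / chart_vec a y 0 b)).
  by congr (@row_mx R 1 2 2 _ _); apply/rowP => m; rewrite !mxE.
rewrite real_rowK; apply/rowP => m; rewrite [LHS]mxE [RHS]mxE mulrC; congr (_ * _).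
rewrite [RHS]mxE.
rewrite (bigD1 (lift b m)) //= big1 => [|j jm]; rewrite [(inc _ _)^T _ _]mxE [inc _ _ _ _]mxE.
  by rewrite eqxx mulr1 addr0.
by rewrite (negbTE jm) mulr0.
Qed.

(** Both charts describe the same line, normalised at different coordinates. *)
Lemma chart_transition : chart_vec b (transition a b x) = (v 0 b)^-1 *: v.
Proof.
rewrite chart_vecE zvec_transition -scalemxAl -mulmxA tr_inc mulmxBr mulmx1 mulmxA.
by rewrite mul_ecol mul_scalar_mx scalerBr scalerA mulVf // scale1r addrC subrK.
Qed.

Lemma derive_transition (X : V) : is_derive x X (transition a b)
  (real_row ((v 0 b)^-1 *: (dchart_vec a X *m aff b (transition a b x)))).
Proof.
apply/mderiv_zvec; rewrite real_rowK.
under [X in mderiv X]eq_fun do rewrite zvec_transition.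
have h := mderiv_scale (cderiv_inv vb (mderiv_chart a x X 0 b))
  (mderiv_mul (mderiv_chart a x X) (mderiv_cst x X ((inc R b)^T))).
suff -> : (v 0 b)^-1 *: (dchart_vec a X *m aff b (transition a b x)) =
   - (dchart_vec a X 0 b / v 0 b ^+ 2) *: (v *m (inc R b)^T) +
   (v 0 b)^-1 *: (dchart_vec a X *m (inc R b)^T + v *m 0) by exact: h.
rewrite mulmx0 addr0 /aff mulmxBr zvec_transition mulmxA.
rewrite mul_ecol mul_scalar_mx; move: (_ *m (inc R b)^T) (_ *m (inc R b)^T) => vi ui.
rewrite scalerBr addrC -scaleNr scalerA scalerA; congr (_ *: _ + _).
by field.
Qed.
End Transition.

Lemma jfield_compatible a b (x X : V) : 0 < disc H (chart_vec a x) ->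
  chart_vec a x 0 b != 0 ->
  'D_(X *m jfield H a x) (transition a b) x =
  'D_X (transition a b) x *m jfield H b (transition a b x).
Proof.
move=> Dx vb; have [_ ->] := derive_transition vb (X *m jfield H a x).
have [_ ->] := derive_transition vb X.
apply: (can_inj (@zvecK R)); rewrite real_rowK.
rewrite [RHS](zvec_jfield b (transition a b x) (real_row _)) real_rowK -[RHS]scalemxAl.
congr (_ *: _).
rewrite -mulmxA aff_jmx chart_transition // splittingZ ?invr_eq0 //.
rewrite dchart_jfield -(scalemxAl 'i) -(scalemxAr 'i); congr (_ *: _).
rewrite -!mulmxA mulmxBl mul1mx -[ecol _ _ *m _ *m _]mulmxA.
have -> : chart_vec a x = chart_vec a x 0 b *: chart_vec b (transition a b x).
  by rewrite chart_transition // scalerA mulfV // scale1r.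
by rewrite -(scalemxAl (chart_vec a x 0 b)) chart_aff scaler0 mulmx0 subr0.
Qed.
End OcsFields.

(** * Integrability *)

Section IsOcs.
Variable R : realType.
Local Notation V := 'rV[R]_4.
Local Notation C := R[i].
Variables (H : 'M[C]_3) (HH : adj H = H).

Lemma smooth_derive (D : set V) (X : vfield R) (x v : V) :
  smooth_on D X -> D x -> is_derive x v X ('D_v X x).
Proof. by move=> sX Dx; apply/derivableP/diff_derivable; have [dX _] := sX 1%N; exact: dX. Qed.

(** After expansion by the Leibniz rule the derivatives of X and Y cancel, leaving
    Y (D_XJ M - D_X M M) - X (D_YJ M - D_Y M M), where both brackets vanish by the
    Cauchy-Riemann equation. *)
Lemma nijenhuis_cauchy_riemann (J : V -> 'M[R]_4) (M : V -> 'M[C]_2) (X Y : vfield R) (x : V)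
    (dX dY : V -> V) (dM : V -> 'M[C]_2) :
  (forall y v, zvec (v *m J y) = zvec v *m M y) -> M x *m M x = - 1%:M ->
  (forall v, is_derive x v X (dX v)) -> (forall v, is_derive x v Y (dY v)) ->
  (forall v, mderiv M x v (dM v)) ->
  (forall v, mderiv M x (v *m J x) (dM v *m M x)) ->
  nijenhuis J X Y x = 0.
Proof.
move=> JM MM hX hY hM holo.
have lieE (Z W : vfield R) wZ wW :
    mderiv (fun y => zvec (W y)) x (Z x) wW -> mderiv (fun y => zvec (Z y)) x (W x) wZ ->
    zvec (lie Z W x) = wW - wZ.
  rewrite -[wW]real_rowK -[wZ]real_rowK => /mderiv_zvec[_ <-] /mderiv_zvec[_ <-].
  exact: zvecB.
have zX v := (mderiv_zvec X x v (dX v)).1 (hX v).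
have zY v := (mderiv_zvec Y x v (dY v)).1 (hY v).
have zJ (Z : vfield R) v w N : mderiv (fun y => zvec (Z y)) x v w -> mderiv M x v N ->
    mderiv (fun y => zvec (act J Z y)) x v (w *m M x + zvec (Z x) *m N).
  by move=> hZ hN; under [X in mderiv X]eq_fun do rewrite /act JM; exact: mderiv_mul.
have e1 := lieE (act J X) (act J Y) _ _ (zJ Y _ _ _ (zY _) (holo _)) (zJ X _ _ _ (zX _) (holo _)).
have e2 := lieE (act J X) Y _ _ (zY _) (zJ X _ _ _ (zX _) (hM _)).
have e3 := lieE X (act J Y) _ _ (zJ Y _ _ _ (zY _) (hM _)) (zX _).
have e4 := lieE X Y _ _ (zY _) (zX _).
(* The four brackets of the Nijenhuis tensor, in complex coordinates. *)
have combine (a b c d : V) za zb zc zd :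
    zvec a = za -> zvec b = zb -> zvec c = zc -> zvec d = zd ->
    za - zb *m M x - zc *m M x - zd = 0 -> a - b *m J x - c *m J x - d = 0.
  move=> <- <- <- <- h; apply: (can_inj (@zvecK R)).
  by rewrite [RHS]zvec0 -h 3!zvecB (JM x b) (JM x c).
apply: (combine _ _ _ _ _ _ _ _ e1 e2 e3 e4) => {e1 e2 e3 e4}.
move: (M x) MM (zvec (dX _)) (zvec (dX _)) (zvec (dY _)) (zvec (dY _)) => N NN a b c d.
rewrite !(mulmxBl, mulmxDl) -!mulmxA NN !mulmxN !mulmx1.
by apply/rowP => j; rewrite !mxE; ring.
Qed.

Lemma nijenhuis_jfield k (X Y : vfield R) (x : V) :
  let D := [set x | 0 < disc H (chart_vec k x)] in
  smooth_on D X -> smooth_on D Y -> D x -> nijenhuis (jfield H k) X Y x = 0.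
Proof.
move=> D sX sY Dx.
have sM : msmooth D (jmx H k).
  by apply: msmooth_jmx; [exact: open_disc_pos | move=> y].
have [dM hM] := choice (fun p => msmooth_deriv p sM Dx).
apply: (@nijenhuis_cauchy_riemann (jfield H k) (jmx H k) X Y x (fun v => 'D_v X x) (fun v => 'D_v Y x) dM).
- exact: zvec_jfield.
- exact: (jmx_sqr HH Dx).
- by move=> v; exact: smooth_derive sX Dx.
- by move=> v; exact: smooth_derive sY Dx.
- exact: hM.
- by move=> v; rewrite -(jmx_cauchy_riemann HH Dx (hM v) (hM _)).
Qed.

(** The hypothesis describes U as the set where the compression of H is not scalar. *)
Lemma jfield_is_OCS (U : set (P2 R)) :
  (forall k x, U (chart k x) <-> 0 < disc H (chart_vec k x)) ->
  is_OCS U (jfield H).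
Proof.
move=> UE; have UD k : chart k @^-1` U = [set x | 0 < disc H (chart_vec k x)].
  by apply/seteqP; split=> x /= /UE.
split.
- by move=> k; rewrite UD; exact: open_disc_pos.
- by move=> a b x X /UE; exact: jfield_compatible.
- move=> k; rewrite UD; apply: smooth_realify; first exact: open_disc_pos.
  by apply: msmooth_jmx => //; exact: open_disc_pos.
- move=> k x /UE Dx; apply: eq_realify => X.
  by rewrite mulmxA !zvec_jfield -mulmxA jmx_sqr // !mulmxN !mulmx1 zvecN.
- move=> k X Y; rewrite UD => sX sY x /UE Dx; exact: nijenhuis_jfield.
- by move=> k x X Y /UE; exact: jfield_orthogonal.
Qed.
End IsOcs.

(** * Flags and the twistor projection *)

Section Flags.
Variable R : realType.
Local Notation C := R[i].
Implicit Types (p q v : 'rV[C]_3) (l : 'cV[C]_3).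

(** Case analysis producing the indices in the ring notation used by cross products. *)
Lemma ord3_ind (P : 'I_3 -> Prop) : P 0 -> P 1 -> P 2%:R -> forall i, P i.
Proof.
move=> h0 h1 h2 [[|[|[|//]]] hi].
- by rewrite (_ : Ordinal hi = 0) //; exact/val_inj.
- by rewrite (_ : Ordinal hi = 1) //; exact/val_inj.
- by rewrite (_ : Ordinal hi = 2%:R) //; exact/val_inj.
Qed.

Lemma sum_ord3 (F : 'I_3 -> C) : \sum_i F i = F 0 + F 1 + F 2%:R.
Proof.
rewrite !big_ord_recl big_ord0 addr0 addrA.
by congr (F _ + F _ + F _); exact/val_inj.
Qed.

Lemma ord3_addE : (((0 + 1)%R = 1%R :> 'I_3) * ((0 + 2%:R)%R = 2%:R%R :> 'I_3)
  * ((1 + 1)%R = 2%:R%R :> 'I_3) * ((1 + 2%:R)%R = 0%R :> 'I_3)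
  * ((2%:R + 1)%R = 0%R :> 'I_3) * ((2%:R + 2%:R)%R = 1%R :> 'I_3))%type.
Proof. by do ! split; exact/val_inj. Qed.

Lemma cross_mull l m : cross l m *m l = 0.
Proof.
apply/matrixP => i j; rewrite (ord1 i) (ord1 j) !mxE sum_ord3 !mxE !ord3_addE; ring.
Qed.
Lemma cross_mulr l m : cross l m *m m = 0.
Proof.
apply/matrixP => i j; rewrite (ord1 i) (ord1 j) !mxE sum_ord3 !mxE !ord3_addE; ring.
Qed.

(** The vector triple product of v with l x m is a combination of v l and v m, both zero,
    so v and l x m have proportional coordinates. *)
Lemma cross_span l m v : cross l m != 0 -> v *m l = 0 -> v *m m = 0 ->
  exists c, v = c *: cross l m.
Proof.
move=> c0 vl vm.
have el : v 0 0 * l 0 0 + v 0 1 * l 1 0 + v 0 2%:R * l 2%:R 0 = 0.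
  by have := congr1 (fun M : 'M[C]_1 => M 0 0) vl; rewrite !mxE sum_ord3.
have em : v 0 0 * m 0 0 + v 0 1 * m 1 0 + v 0 2%:R * m 2%:R 0 = 0.
  by have := congr1 (fun M : 'M[C]_1 => M 0 0) vm; rewrite !mxE sum_ord3.
have lc (x y r s : C) : r * 0 + s * 0 = x - y -> x = y.
  by rewrite !mulr0 addr0 => /esym/eqP; rewrite subr_eq0 => /eqP.
have key i j : v 0 i * cross l m 0 j = v 0 j * cross l m 0 i.
  elim/ord3_ind: i; elim/ord3_ind: j => //; rewrite !mxE !ord3_addE.
  - apply: (lc _ _ (- m 2%:R 0) (l 2%:R 0)); rewrite -{1}el -em; ring.
  - apply: (lc _ _ (m 1 0) (- l 1 0)); rewrite -{1}el -em; ring.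
  - apply: (lc _ _ (m 2%:R 0) (- l 2%:R 0)); rewrite -{1}el -em; ring.
  - apply: (lc _ _ (- m 0 0) (l 0 0)); rewrite -{1}el -em; ring.
  - apply: (lc _ _ (- m 1 0) (l 1 0)); rewrite -{1}el -em; ring.
  - apply: (lc _ _ (m 0 0) (- l 0 0)); rewrite -{1}el -em; ring.
have [j cj] : exists j, cross l m 0 j != 0.
  apply: contrapT => h; case/eqP: c0; apply/rowP => j; rewrite [RHS]mxE.
  by apply/eqP/negPn/negP => hj; apply: h; exists j.
exists (v 0 j / cross l m 0 j); apply/rowP => i.
by rewrite [RHS]mxE mulrAC -key mulfK.
Qed.

Lemma pt_eqP (K : fieldType) (U : vectType K) (v w : U) (v0 : v != 0) (w0 : w != 0) :
  pt v0 = pt w0 <-> exists c, v = c *: w.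
Proof.
split=> [/(congr1 val) /= e|[c e]].
  by apply/vlineP; rewrite -e memv_line.
apply: val_inj => /=; apply/eqP; rewrite eqEdim !dim_vline v0 w0 leqnn andbT.
by apply/vlineP; exists c.
Qed.

Lemma pt_hom (K : fieldType) (U : vectType K) (P : Defs.proj U) : pt (hom_neq0 P) = P.
Proof.
apply: val_inj => /=; apply/eqP; rewrite eqEdim dim_vline hom_neq0 (eqP (valP P)) andbT.
by rewrite -memvE memv_pick.
Qed.

Lemma incident_pt p l (p0 : p != 0) (l0 : l != 0) : p *m l = 0 ->
  incident (pt p0, pt l0).
Proof.
rewrite /incident /=; have [c _ ->] := hom_pt p0; have [d _ ->] := hom_pt l0.
by move=> pl; rewrite -scalemxAl -scalemxAr pl !scaler0.
Qed.

Definition mkflag p l (p0 : p != 0) (l0 : l != 0) (pl : p *m l = 0) : flag R :=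
  exist (fun x => incident x) _ (incident_pt p0 l0 pl).

Lemma mul_homP (A : 'M[C]_3) p l (p0 : p != 0) (l0 : l != 0) :
  Defs.hom (pt p0) *m A *m Defs.hom (pt l0) = 0 <-> p *m A *m l = 0.
Proof.
have [c c0 ->] := hom_pt p0; have [d d0 ->] := hom_pt l0.
rewrite -!scalemxAl -scalemxAr; split=> [/eqP|->]; last by rewrite !scaler0.
by rewrite !scaler_eq0 (negbTE c0) (negbTE d0) => /eqP.
Qed.

Lemma surface_mkflag (A : 'M[C]_3) p l (p0 : p != 0) (l0 : l != 0) (pl : p *m l = 0) :
  surface A (mkflag p0 l0 pl) <-> p *m A *m l = 0.
Proof. exact: mul_homP. Qed.

(** The cross product is, up to scale, the only row killed by both columns (cross_span), so
    two linear equations describe the fiber. *)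
Lemma twistorP (f : flag R) q (q0 : q != 0) : twistor f = pt q0 <->
  q *m adj (Defs.hom (val f).1) = 0 /\ q *m Defs.hom (val f).2 = 0.
Proof.
have [c c0 hc] := hom_pt (adj_neq0 (hom_neq0 (val f).1)).
pose n0 := cross_flag_neq0 f.
have aE : Defs.hom (star (val f).1) = c *: adj (Defs.hom (val f).1) by exact: hc.
split=> [e|[h1 h2]].
  have [d ->] := (pt_eqP q0 n0).1 (esym e).
  split; last by rewrite -scalemxAl cross_mulr scaler0.
  apply: (scalerI c0); rewrite scalemxAr -aE -scalemxAl cross_mull.
  by rewrite !scaler0.
apply/esym/(pt_eqP q0 n0); apply: cross_span => //.
by rewrite aE -scalemxAr h1 scaler0.
Qed.

End Flags.

(** * Hermitian normal form of the surface *)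

Section NormalForm.
Variable R : realType.
Local Notation C := R[i].
Implicit Types (p q v : 'rV[C]_3) (l : 'cV[C]_3) (A H : 'M[C]_3).

Lemma mul_adj_eq0 v : v *m adj v = 0 -> v = 0.
Proof.
by move=> h; apply: trace_mul_adj_eq0; rewrite h mxtrace0.
Qed.

(** If pA = a p, Al = a l and pl = 0, the two differentials in the Jacobian criterion are
    proportional at the flag (p, l). *)
Lemma no_common_eigen A p l a : smooth_surface A -> p != 0 -> l != 0 ->
  p *m A = a *: p -> A *m l = a *: l -> p *m l != 0.
Proof.
move=> sA p0 l0 pA lA; apply/eqP => pl.
have Sf : surface A (mkflag p0 l0 pl).
  by apply/surface_mkflag; rewrite pA -scalemxAl pl scaler0.
have := sA _ Sf; rewrite /mkflag /=.
have -> : Defs.hom (pt p0) *m A = a *: Defs.hom (pt p0).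
  by have [c _ ->] := hom_pt p0; rewrite -scalemxAl pA scalerA mulrC -scalerA.
have -> : A *m Defs.hom (pt l0) = a *: Defs.hom (pt l0).
  by have [c _ ->] := hom_pt l0; rewrite -scalemxAr lA scalerA mulrC -scalerA.
rewrite linearZ /= -scale_row_mx => h.
set r := row_mx _ _ in h.
have : (\rank (col_mx r (a *: r)) <= 1)%N.
  have -> : col_mx r (a *: r) = col_mx 1%:M a%:M *m r.
    by rewrite mul_col_mx mul1mx mul_scalar_mx.
  exact: leq_trans (mxrankM_maxr _ _) (rank_leq_row _).
by rewrite h.
Qed.

(** Conjugating p A l = 0 along j turns the surface of A into that of its adjoint. *)
Lemma jinv_adj A : @flag_j R @` (surface A) = surface A ->
  forall p l, p != 0 -> l != 0 -> p *m l = 0 -> p *m A *m l = 0 ->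
  p *m adj A *m l = 0.
Proof.
move=> jA p l p0 l0 pl pAl.
have Sf : surface A (mkflag p0 l0 pl) by apply/surface_mkflag.
have : surface A (flag_j (mkflag p0 l0 pl)) by rewrite -jA; exists (mkflag p0 l0 pl).
rewrite /surface /= /stard /star => /mul_homP.
have [c c0 ->] := hom_pt p0; have [d d0 ->] := hom_pt l0.
rewrite !adjmxZ -!scalemxAl -scalemxAr => /eqP.
rewrite !scaler_eq0 !conjc_eq0 (negbTE c0) (negbTE d0) /= => /eqP e.
by apply/eqP; rewrite -adjmx_eq0 !adjmxM adjmxK mulmxA e.
Qed.

(** For an eigenvector p, every l with p l = 0 gives a flag of the surface, so p is also an
    eigenvector of the adjoint of A; pairing with p identifies the eigenvalue. *)
Lemma left_eigen_right A p a : @flag_j R @` (surface A) = surface A ->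
  p != 0 -> p *m A = a *: p -> A *m adj p = a *: adj p.
Proof.
move=> jA p0 pA.
pose w := p *m adj A.
have np : (sqnorm p)%:C != 0 by exact: sqnormC_neq0.
have pp : p *m adj p = (sqnorm p)%:C%:M by rewrite hermE sqnormE.
have wp : w *m adj p = (a^*%C * (sqnorm p)%:C)%:M.
  rewrite /w -mulmxA -adjmxM pA adjmxZ -scalemxAr pp.
  by rewrite -scale_scalar_mx.
have e : w = a^*%C *: p.
  apply/eqP; rewrite -subr_eq0; apply/eqP.
  pose u := w - a^*%C *: p; rewrite -/u.
  have up : u *m adj p = 0.
    by rewrite mulmxBl wp -scalemxAl pp -scale_scalar_mx subrr.
  have [->//|u0] := eqVneq u 0.
  have pu : p *m adj u = 0 by exact: mul_adjC.
  have wu : w *m adj u = 0.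
    apply: (jinv_adj jA p0 _ pu); first exact: adj_neq0.
    by rewrite pA -scalemxAl pu scaler0.
  apply: mul_adj_eq0; rewrite {1}/u mulmxBl wu -scalemxAl pu scaler0 subr0.
  by [].
by apply: (can_inj (@adjmxK R _ _)); rewrite adjmxM adjmxK -/w e adjmxZ adjmxK.
Qed.

(** In a Schur basis the matrix is triangular. Its first basis vector is an eigenvector, so
    by left_eigen_right the first column also vanishes off the diagonal; iterating, A is
    diagonal in an orthonormal basis. *)
Lemma orthonormal_eigenbasis A : @flag_j R @` (surface A) = surface A ->
  exists e : 'I_3 -> 'rV[C]_3, exists n : 'I_3 -> C,
  [/\ forall i j, e i *m adj (e j) = (i == j)%:R%:M,
      forall i, e i *m A = n i *: e i, forall i, A *m adj (e i) = n i *: adj (e i)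
    & forall X Y : 'M[C]_3, (forall i, e i *m X = e i *m Y) -> X = Y].
Proof.
move=> jA; have [P Pu tP] := Schur A (isT : (0 < 3)%N).
have adjE m n (X : 'M[C]_(m, n)) : (map_mx Num.conj X^T) = adj X by rewrite /adj map_trmx.
have PP : P *m adj P = 1%:M by have /unitarymxP := Pu; rewrite adjE.
have PP' : adj P *m P = 1%:M by apply: mulmx1C.
pose e i := row i P; pose N := P *m A *m adj P.
have tN : is_trig_mx N.
  by have -> : N = conjmx P A by rewrite (conjymx A Pu) adjE.
have re (X : 'M[C]_3) i j : row i P *m X *m adj (row j P) = ((P *m X *m adj P) i j)%:M.
  have -> : adj (row j P) = col j (adj P) by rewrite /adj map_row tr_row.
  by rewrite -!row_mul [LHS]mx11_scalar !mxE; congr (_%:M); apply: eq_bigr => k _; rewrite !mxE.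
have ee i j : e i *m adj (e j) = (i == j)%:R%:M.
  by rewrite -[e i]mulmx1 re mulmx1 PP mxE.
have Ne i j : e i *m A *m adj (e j) = (N i j)%:M by exact: re.
have eA i : e i *m A = \sum_j N i j *: e j.
  rewrite -row_mul -[P *m A]mulmx1 -PP' mulmxA -/N row_mul mulmx_sum_row.
  by apply: eq_bigr => j _; rewrite mxE.
have e0 i : e i != 0.
  apply/eqP => h; have := ee i i; rewrite h mul0mx eqxx => /matrixP/(_ 0 0).
  by rewrite !mxE eqxx => /eqP; rewrite eq_sym oner_eq0.
have step i : (forall j, j != i -> N i j = 0) ->
    e i *m A = N i i *: e i /\ A *m adj (e i) = N i i *: adj (e i).
  move=> h; have E : e i *m A = N i i *: e i.
    by rewrite eA (bigD1 i) //= big1 ?addr0 // => j /h ->; rewrite scale0r.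
  by split=> //; apply: left_eigen_right.
have low i j : A *m adj (e i) = N i i *: adj (e i) -> j != i -> N j i = 0.
  move=> Ae ji; have := Ne j i; rewrite -mulmxA Ae -scalemxAr ee (negbTE ji).
  by move/matrixP/(_ 0 0); rewrite !mxE mulr0n mulr0 mulr1n => <-.
have up (i j : 'I_3) : (i < j)%N -> N i j = 0 by move/is_trig_mxP: tN; exact.
have [eA0 Ae0] : e 0 *m A = N 0 0 *: e 0 /\ A *m adj (e 0) = N 0 0 *: adj (e 0).
  by apply: step; elim/ord3_ind => // _; exact: up.
have [eA1 Ae1] : e 1 *m A = N 1 1 *: e 1 /\ A *m adj (e 1) = N 1 1 *: adj (e 1).
  by apply: step; elim/ord3_ind => // _; [exact: low | exact: up].
have [eA2 Ae2] : e 2%:R *m A = N 2%:R 2%:R *: e 2%:R /\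
    A *m adj (e 2%:R) = N 2%:R 2%:R *: adj (e 2%:R).
  by apply: step; elim/ord3_ind => // _; exact: low.
exists e, (fun i => N i i); split; [exact: ee | exact: (ord3_ind eA0 eA1 eA2) | exact: (ord3_ind Ae0 Ae1 Ae2) |].
  move=> X Y h; have hP : P *m X = P *m Y.
    by apply/row_matrixP => i; rewrite !row_mul; exact: h.
  by rewrite -[X]mul1mx -[Y]mul1mx -PP' -!mulmxA hP.
Qed.

(** The eigenvalues are pairwise distinct by smoothness. A flag (p, l) with p of coordinates
    (1, 1, 1) in the eigenbasis lies on the surface for one l, and on the surface of the
    adjoint by j-invariance: this says that the three eigenvalues are on a real line of the
    complex plane, so an affine change makes them real and A Hermitian. *)
Lemma normal_form A : smooth_surface A -> @flag_j R @` (surface A) = surface A ->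
  exists H a b, [/\ adj H = H, a != 0 & A = a *: H + b%:M].
Proof.
move=> sA jA; have [e [n [ee eA Ae eX]]] := orthonormal_eigenbasis jA.
have e0 i : e i != 0.
  apply/eqP => h; have := ee i i; rewrite h mul0mx eqxx => /matrixP/(_ 0 0).
  by rewrite !mxE eqxx => /eqP; rewrite eq_sym oner_eq0.
have ndist i j : i != j -> n i != n j.
  move=> ij; apply/eqP => nij.
  have := no_common_eigen sA (e0 i) (adj_neq0 (e0 j)) (eA i).
  by rewrite nij ee (negbTE ij) => /(_ (Ae j)); rewrite raddf0 eqxx.
(* The coordinates of l solve x0 + x1 + x2 = 0 and n0 x0 + n1 x1 + n2 x2 = 0. *)
pose x0 := n 1 - n 2%:R; pose x1 := n 2%:R - n 0; pose x2 := n 0 - n 1.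
pose p := e 0 + e 1 + e 2%:R.
pose l := x0 *: adj (e 0) + x1 *: adj (e 1) + x2 *: adj (e 2%:R).
have comb c0 c1 c2 : (c0 *: e 0 + c1 *: e 1 + c2 *: e 2%:R) *m l =
    (c0 * x0 + c1 * x1 + c2 * x2)%:M.
  rewrite /l !mulmxDl !mulmxDr -!scalemxAl -!scalemxAr !ee /= !(raddf0, scaler0).
  by rewrite !(addr0, add0r) !scalerA !scale_scalar_mx !mulr1 -!raddfD.
have p1 : p = 1 *: e 0 + 1 *: e 1 + 1 *: e 2%:R by rewrite !scale1r.
have l0 : l != 0.
  apply/eqP => h; have := comb 1 0 0; rewrite h mulmx0 mul1r !mul0r !addr0.
  move/matrixP/(_ 0 0); rewrite !mxE mulr1n => /esym/eqP.
  by rewrite subr_eq0 (negbTE (ndist 1 2%:R isT)).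
have p0 : p != 0.
  apply/eqP => h; have : p *m adj (e 0) = 0 by rewrite h mul0mx.
  rewrite /p !mulmxDl !ee /= !raddf0 !addr0 => /matrixP/(_ 0 0).
  by rewrite !mxE => /eqP; rewrite oner_eq0.
have pl : p *m l = 0.
  by rewrite p1 comb -(raddf0 (@scalar_mx C 1)); congr (_%:M); rewrite /x0 /x1 /x2; ring.
have pA (X : 'M[C]_3) (m : 'I_3 -> C) : (forall i, e i *m X = m i *: e i) ->
    p *m X *m l = (m 0 * x0 + m 1 * x1 + m 2%:R * x2)%:M.
  by move=> eX'; rewrite /p !mulmxDl !eX' -comb !mulmxDl.
have pAl : p *m A *m l = 0.
  by rewrite (pA A n eA) -(raddf0 (@scalar_mx C 1)); congr (_%:M); rewrite /x0 /x1 /x2; ring.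
have eadjA i : e i *m adj A = (n i)^*%C *: e i.
  by apply: (can_inj (@adjmxK R _ _)); rewrite adjmxM adjmxK Ae adjmxZ conjcK.
have := jinv_adj jA p0 l0 pl pAl.
rewrite (pA _ _ eadjA) => /matrixP/(_ 0 0); rewrite !mxE mulr1n => coll.
pose a := n 1 - n 0; pose b := n 0; pose h i := (n i - b) / a.
have a0 : a != 0 by rewrite subr_eq0 (ndist 1 0).
have hreal i : (h i)^*%C = h i.
  rewrite /h; have -> (z w : C) : (z / w)^*%C = z^*%C / w^*%C.
    by rewrite conjcM conjc_inv.
  have ca0 : a^*%C != 0 by rewrite conjc_eq0.
  apply/eqP; rewrite eqr_div //; apply/eqP.
  elim/ord3_ind: i.
  - by rewrite subrr conjc0 !mul0r.
  - by rewrite mulrC.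
  - apply/eqP; rewrite -subr_eq0; apply/eqP; rewrite -[RHS]oppr0 -coll /a /b /x0 /x1 /x2 !conjcB; ring.
exists (a^-1 *: (A - b%:M)), a, b; split=> //.
- apply: eX => i.
  have He : a^-1 *: (A - b%:M) *m adj (e i) = h i *: adj (e i).
    by rewrite -scalemxAl mulmxBl Ae mul_scalar_mx -scalerBl scalerA mulrC.
  have eH : e i *m (a^-1 *: (A - b%:M)) = h i *: e i.
    by rewrite -scalemxAr mulmxBr eA mul_mx_scalar -scalerBl scalerA mulrC.
  rewrite eH; apply: (can_inj (@adjmxK R _ _)).
  by rewrite adjmxM adjmxK He adjmxZ hreal.
- by rewrite scalerA mulfV // scale1r subrK.
Qed.
End NormalForm.

(** * The locus of fibers inside the surface *)

Section Discriminant.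
Variable R : realType.
Local Notation C := R[i].
Implicit Types (p q v : 'rV[C]_3) (l : 'cV[C]_3) (A H : 'M[C]_3).

(** On flags the scalar part of the matrix is invisible, so A and H define the same surface. *)
Lemma mul_affine A H a b p l : A = a *: H + b%:M -> p *m l = 0 ->
  p *m A *m l = a *: (p *m H *m l).
Proof.
move=> -> pl; rewrite mulmxDr mulmxDl mul_mx_scalar -scalemxAl pl scaler0 addr0.
by rewrite -scalemxAr -scalemxAl.
Qed.

Lemma mul_perp_id q p : p *m adj q = 0 -> p *m proj_perp q = p.
Proof. by move=> pq; rewrite mulmxBr mulmx1 -scalemxAr mulmxA pq mul0mx scaler0 subr0. Qed.
Lemma perp_mul_id q l : q *m l = 0 -> proj_perp q *m l = l.
Proof. by move=> ql; rewrite mulmxBl mul1mx -scalemxAl -mulmxA ql mulmx0 scaler0 subr0. Qed.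

Lemma compress_disc0 H q : q != 0 -> adj H = H -> disc H q = 0 ->
  compress H q = half_tr H q *: proj_perp q.
Proof. by move=> q0 HH d0; apply/eqP; rewrite -subr_eq0; apply/eqP; exact: disc_eq0. Qed.

Lemma mx_neq0_row m n (M : 'M[C]_(m, n)) : M != 0 -> exists i, row i M != 0.
Proof.
move=> M0; apply: contrapT => h; case/eqP: M0; apply/row_matrixP => i.
by rewrite row0; apply/eqP/negPn/negP => hi; apply: h; exists i.
Qed.

(** Take p = x + y with x and y in the two eigenlines and l the adjoint of the vector of
    their plane orthogonal to p: then p H l is a nonzero multiple of the gap. *)
Lemma fiber_escapes H q : q != 0 -> adj H = H -> 0 < disc H q ->
  exists p l, [/\ p != 0, l != 0, p *m l = 0, p *m adj q = 0 /\ q *m l = 0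
                & p *m H *m l != 0].
Proof.
move=> q0 HH d0; pose P := proj_pos H q; pose L := proj_neg H q; pose T := splitting H q.
have trT : \tr T = 0 by exact: tr_splitting.
have trPi : \tr (proj_perp q) = 2%:R by exact: tr_perp.
have two : (2%:R : C) != 0 by rewrite pnatr_eq0.
have P0 : P != 0.
  apply: contra_neq two => h; have : \tr P = 0 by rewrite h mxtrace0.
  rewrite /P /proj_pos mxtraceZ linearD /= trPi trT addr0 => /eqP.
  by rewrite mulf_eq0 invr_eq0 orbb => /eqP.
have L0 : L != 0.
  apply: contra_neq two => h; have : \tr L = 0 by rewrite h mxtrace0.
  rewrite /L /proj_neg mxtraceZ linearB /= trPi trT subr0 => /eqP.
  by rewrite mulf_eq0 invr_eq0 orbb => /eqP.
have [x [x0 xT]] : exists x : 'rV[C]_3, x != 0 /\ x *m T = x.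
  by have [i x0] := mx_neq0_row P0; exists (row i P); rewrite -row_mul posT.
have [y [y0 yT]] : exists y : 'rV[C]_3, y != 0 /\ y *m T = - y.
  by have [i y0] := mx_neq0_row L0; exists (row i L); rewrite -row_mul negT // linearN.
have aT : adj T = T by exact: adj_splitting.
have xy : x *m adj y = 0.
  have : x *m adj y = - (x *m adj y).
    by rewrite -{1}xT -mulmxA -{1}aT -adjmxM yT adjmxN mulmxN.
  move/eqP; rewrite -addr_eq0 -mulr2n -scaler_nat scaler_eq0 (negbTE two).
  by move/eqP.
have qT : q *m T = 0 by exact: mul_splitting.
have Tq : T *m adj q = 0 by exact: splitting_adj.
have qx : q *m adj x = 0 by rewrite -xT adjmxM aT mulmxA qT mul0mx.
have qy : q *m adj y = 0.
  have : q *m adj (- y) = 0 by rewrite -yT adjmxM aT mulmxA qT mul0mx.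
  by rewrite adjmxN mulmxN => /eqP; rewrite oppr_eq0 => /eqP.
have xx : x *m adj x = (sqnorm x)%:C%:M by rewrite hermE sqnormE.
have yy : y *m adj y = (sqnorm y)%:C%:M by rewrite hermE sqnormE.
(* The vector of the plane of x and y orthogonal to x + y, up to scale. *)
pose w := (sqnorm y)%:C *: x - (sqnorm x)%:C *: y.
have aw : adj w = (sqnorm y)%:C *: adj x - (sqnorm x)%:C *: adj y.
  by rewrite adjmxB !adjmxZ !conjc_real.
have sx := sqnormC_neq0 x0; have sy := sqnormC_neq0 y0.
have pl : (x + y) *m adj w = 0.
  rewrite aw mulmxDl !mulmxBr -!scalemxAr xx yy xy (mul_adjC xy) !scaler0 subr0 sub0r.
  by rewrite !scale_scalar_mx mulrC subrr.
have xyp : (x + y) *m proj_perp q = x + y.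
  by apply: mul_perp_id; rewrite mulmxDl (mul_adjC qx) (mul_adjC qy) addr0.
have wl : proj_perp q *m adj w = adj w.
  by apply: perp_mul_id; rewrite aw mulmxBr -!scalemxAr qx qy !scaler0 subr0.
have xyw : (x + y) *m H *m adj w = ((gap H q)%:C * (2%:R * (sqnorm x)%:C * (sqnorm y)%:C))%:M.
  have -> : (x + y) *m H *m adj w = (x + y) *m (proj_perp q *m H *m proj_perp q) *m adj w.
    by rewrite -!mulmxA wl [(x + y) *m (proj_perp q *m _)]mulmxA xyp.
  rewrite compressE // mulmxDr mulmxDl -(scalemxAr (half_tr H q)) xyp -scalemxAl pl scaler0 add0r.
  rewrite -(scalemxAr (gap H q)%:C) -scalemxAl [(x + y) *m _]mulmxDl xT yT.
  rewrite aw mulmxBl !mulmxBr -!scalemxAr xx yy xy (mul_adjC xy) !scaler0 subr0 sub0r opprK.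
  rewrite !scale_scalar_mx -raddfD scale_scalar_mx; congr (_%:M); ring.
have h0 : (x + y) *m H *m adj w != 0.
  rewrite xyw; apply/eqP => /(congr1 (fun M : 'M[C]_1 => M 0 0)).
  rewrite !mxE mulr1n => /eqP; rewrite !mulf_eq0 (negbTE two) (negbTE sx) (negbTE sy).
  by rewrite (negbTE (gapC_neq0 d0)).
exists (x + y), (adj w); split=> //.
- by apply: contra_neq h0 => ->; rewrite !mul0mx.
- by apply: contra_neq h0 => ->; rewrite mulmx0.
- by split; [rewrite mulmxDl (mul_adjC qx) (mul_adjC qy) addr0
            | rewrite aw mulmxBr -!scalemxAr qx qy !scaler0 subr0].
Qed.

(** If the compression is a scalar t then p H l = t p l = 0 on the whole fiber; otherwise
    fiber_escapes provides a flag of the fiber outside the surface. *)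
Lemma D0_disc A H a b q (q0 : q != 0) : adj H = H -> a != 0 -> A = a *: H + b%:M ->
  D0 (surface A) (pt q0) <-> disc H q = 0.
Proof.
move=> HH a0 AE; split=> [Dq|d0 f /twistorP [qp ql]].
  apply/eqP/negPn/negP => d0.
  have {}d0 : 0 < disc H q by rewrite lt_neqAle eq_sym d0 disc_ge0.
  have [p [l [p0 l0 pl [pq ql]]]] := fiber_escapes q0 HH d0.
  have /Dq/surface_mkflag : (@twistor R @^-1` [set pt q0]) (mkflag p0 l0 pl).
    apply/twistorP; have [c _ hc] := hom_pt p0; have [d _ hd] := hom_pt l0.
    rewrite /= hc hd adjmxZ -!scalemxAr ql; split; last by rewrite scaler0.
    by rewrite (mul_adjC pq) scaler0.
  rewrite (mul_affine AE pl) => /eqP; rewrite scaler_eq0 (negbTE a0) /= => /eqP ->.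
  by rewrite eqxx.
rewrite /surface /=; set p := Defs.hom _ in qp *; set l := Defs.hom _ in ql *.
have pl : p *m l = 0 by exact/eqP/(valP f).
have pq := mul_adjC qp.
rewrite (mul_affine AE pl).
have -> : p *m H *m l = p *m compress H q *m l.
  rewrite /compress -!mulmxA (perp_mul_id ql) [p *m (proj_perp q *m _)]mulmxA.
  by rewrite mul_perp_id.
by rewrite compress_disc0 // -scalemxAr mul_perp_id // -scalemxAl pl !scaler0.
Qed.
End Discriminant.

(** * Behaviour near a fiber inside the surface *)

Section Degenerate.
Variable R : realType.
Local Notation C := R[i].
Variables (H : 'M[C]_3) (HH : adj H = H).

(** What smoothness says of H: no left eigenvector is killed by a right eigenvector of the
    same eigenvalue. *)
Definition eigen_transverse := forall (p : 'rV[C]_3) (l : 'cV[C]_3) a,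
  p != 0 -> l != 0 -> p *m H = a *: p -> H *m l = a *: l -> p *m l != 0.

(** The half trace of the compression is governed by the Rayleigh quotient of H at q. *)
Lemma half_trE q : q != 0 ->
  half_tr H q = (\tr H - (sqnorm q)^-1%:C * \tr (q *m H *m adj q)) / 2%:R.
Proof.
move=> q0; rewrite /half_tr /compress mxtrace_mulC mulmxA perp_idem //.
rewrite mulmxBl mul1mx linearB /= -scalemxAl mxtraceZ -mulmxA mxtrace_mulC.
by rewrite [in RHS]mxtrace_mulC !mulmxA.
Qed.

Section Point.
Variable q : 'rV[C]_3.
Hypotheses (q0 : q != 0) (d0 : disc H q = 0) (tr : eigen_transverse).
Local Notation tau := (half_tr H q).
(** The component of q H orthogonal to q; it vanishes exactly when q is an eigenvector. *)
Definition tilt : 'rV[C]_3 := q *m H *m proj_perp q.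

Lemma tilt_adj : tilt *m adj q = 0.
Proof. by rewrite -mulmxA perp_adj // mulmx0. Qed.

Lemma adj_perp_id (n : 'rV[C]_3) : n *m adj q = 0 -> proj_perp q *m adj n = adj n.
Proof. by move=> nq; apply: perp_mul_id; exact: mul_adjC. Qed.

(** Where the compression is scalar, vectors of the orthogonal plane are mapped to multiples
    of themselves up to a component along q, and that component is the pairing with tilt. *)
Lemma degenerate_eigen (n : 'rV[C]_3) : n *m adj q = 0 -> n *m adj tilt = 0 ->
  n *m H = tau *: n.
Proof.
move=> nq nt.
have E : n *m H *m proj_perp q = tau *: n.
  have -> : n *m H *m proj_perp q = n *m compress H q.
    by rewrite /compress !mulmxA (mul_perp_id nq).
  by rewrite compress_disc0 // -scalemxAr mul_perp_id.
have F : n *m H *m adj q = 0.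
  apply/eqP; rewrite -adjmx_eq0 !adjmxM adjmxK HH mulmxA.
  rewrite -(adj_perp_id nq) mulmxA -/tilt; apply/eqP; exact: mul_adjC.
rewrite -[n *m H]mulmx1 -[1%:M](subrK (proj_line q)) -/(proj_perp q) mulmxDr E.
by rewrite -scalemxAr mulmxA F mul0mx scaler0 addr0.
Qed.

(** If q were an eigenvector, the whole plane orthogonal to q would be an eigenspace of H;
    two orthogonal vectors of this plane contradict transversality. *)
Lemma tilt_neq0 : tilt != 0.
Proof.
apply/eqP => b0.
have Pi0 : proj_perp q != 0.
  apply/eqP => h; have := tr_perp q0; rewrite h mxtrace0 => /eqP.
  by rewrite eq_sym pnatr_eq0.
have [i n0] := mx_neq0_row Pi0; set n := row i _ in n0.
have nq : n *m adj q = 0 by rewrite -row_mul perp_adj // row0.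
have nH : n *m H = tau *: n.
  by apply: degenerate_eigen => //; rewrite b0 adjmx0 mulmx0.
pose m := cross (adj q) (adj n).
have m0 : m != 0.
  by have := cross_adj_neq0 q0 (adj_neq0 n0) (oner_neq0 _) (mul_adjC nq); rewrite scale1r.
have mH : m *m H = tau *: m.
  by apply: degenerate_eigen; rewrite ?b0 ?adjmx0 ?mulmx0 // cross_mull.
have Hm : H *m adj m = tau *: adj m.
  by rewrite -{1}HH -adjmxM mH adjmxZ conj_half_tr.
have := tr n0 (adj_neq0 m0) nH Hm.
by rewrite (mul_adjC (cross_mulr _ _)) eqxx.
Qed.

(** An eigenvector n of H orthogonal to q' is an eigenvector of the compression at q', so it
    spans one of the two eigenlines; the sign of m tells which one. *)
Lemma splitting_eigen q' (n : 'rV[C]_3) (m : R) : q' != 0 -> n != 0 ->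
  n *m adj q' = 0 -> n *m H = tau *: n -> tau - half_tr H q' = m%:C -> m != 0 ->
  0 < disc H q' /\ n *m splitting H q' = (Num.sg m)%:C *: n.
Proof.
move=> q'0 n0 nq nH hm m0.
have nB : n *m tracefree H q' = m%:C *: n.
  rewrite mulmxBr /compress !mulmxA (mul_perp_id nq) nH -scalemxAl (mul_perp_id nq).
  by rewrite -scalemxAr (mul_perp_id nq) -scalerBl hm.
have dm : disc H q' = m ^+ 2.
  have : n *m (tracefree H q' *m tracefree H q') = (m ^+ 2)%:C *: n.
    by rewrite mulmxA nB -scalemxAl nB scalerA -rmorphM expr2.
  rewrite (tracefree_sqr q'0 HH) -scalemxAr (mul_perp_id nq) => /eqP.
  by rewrite -subr_eq0 -scalerBl scaler_eq0 (negbTE n0) orbF subr_eq0 => /eqP /complexI.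
split; first by rewrite dm exprn_even_gt0 //= m0.
rewrite /splitting -scalemxAr nB scalerA /gap dm sqrtr_sqr -rmorphM /=; congr (_%:C *: _).
by rewrite {2}[m]numEsg mulrCA mulVf ?mulr1 // normr_eq0.
Qed.
End Point.

Lemma tr_form2 (X : 'M[C]_3) (u v : 'rV[C]_3) (c s : C) :
  \tr ((c *: u + s *: v) *m X *m adj (c *: u + s *: v)) =
  c * c^*%C * \tr (u *m X *m adj u) + c * s^*%C * \tr (u *m X *m adj v)
  + s * c^*%C * \tr (v *m X *m adj u) + s * s^*%C * \tr (v *m X *m adj v).
Proof.
have left2 (w : 'cV[C]_3) : \tr ((c *: u + s *: v) *m X *m w) =
    c * \tr (u *m X *m w) + s * \tr (v *m X *m w).
  by rewrite 2!mulmxDl -4!scalemxAl mxtraceD 2!mxtraceZ.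
have right2 (w : 'rV[C]_3) : \tr (w *m (c^*%C *: adj u + s^*%C *: adj v)) =
    c^*%C * \tr (w *m adj u) + s^*%C * \tr (w *m adj v).
  by rewrite mulmxDr -2!scalemxAr mxtraceD 2!mxtraceZ.
rewrite adjmxD 2!adjmxZ left2 2!right2.
by ring.
Qed.

(** Along q + t (b - z q) the Rayleigh quotient of H varies, to first order, by a positive
    multiple of t; the exact formula determines the sign for small t. *)
Lemma half_tr_along_path (q : 'rV[C]_3) (z : C) (t : R) : q != 0 -> disc H q = 0 ->
  let b := tilt q in let q' := q + t%:C *: (b - z *: q) in
  q' != 0 ->
  half_tr H q - half_tr H q' = (t * (sqnorm b * (2 + t *
   (complex.Re (half_tr H q) - complex.Re ((sqnorm q)^-1%:C * \tr (q *m H *m adj q)) - 2 * complex.Re z))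
    / (2 * sqnorm q')))%:C.
Proof.
move=> q0 d0 b q' q'0.
have bq : b *m adj q = 0 by exact: tilt_adj.
have conj_real (x : C) : x^*%C = x -> x = (complex.Re x)%:C.
  by case: x => x y [] /eqP; rewrite eq_sym -addr_eq0 -mulr2n mulrn_eq0 /= => /eqP ->.
have trr (u w : 'rV[C]_3) : (\tr (u *m H *m adj w))^*%C = \tr (w *m H *m adj u).
  by rewrite -mxtr_adj !adjmxM adjmxK HH mulmxA.
set tau := half_tr H q; set rho := (sqnorm q)^-1%:C * _.
have tauE : tau = (complex.Re tau)%:C by apply: conj_real; exact: conj_half_tr.
have rhoE : rho = (complex.Re rho)%:C.
  by apply: conj_real; rewrite conjcM conjc_real trr.
have n0 := sqnormC_neq0 q0; have n0' := sqnormC_neq0 q'0.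
have trn (u : 'rV[C]_3) : \tr (u *m adj u) = (sqnorm u)%:C.
  by rewrite hermE sqnormE mxtrace_scalar.
have pb : proj_perp q *m adj b = adj b by exact: adj_perp_id.
have hqb : \tr (q *m H *m adj b) = (sqnorm b)%:C.
  by rewrite -pb mulmxA trn.
have hbq : \tr (b *m H *m adj q) = (sqnorm b)%:C by rewrite -trr hqb conjc_real.
have hbb : \tr (b *m H *m adj b) = tau * (sqnorm b)%:C.
  have -> : b *m H *m adj b = b *m compress H q *m adj b.
    by rewrite /compress !mulmxA -[b *m _ *m H]mulmxA -!mulmxA pb !mulmxA (mul_perp_id bq).
  by rewrite compress_disc0 // -scalemxAr (mul_perp_id bq) -scalemxAl mxtraceZ trn.
have hqq : \tr (q *m H *m adj q) = rho * (sqnorm q)%:C.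
  by rewrite /rho mulrAC rcinv mulVf // mul1r.
pose c := 1 - t%:C * z.
have q'E : q' = c *: q + t%:C *: b.
  by rewrite /q' scalerBr addrCA addrC scalerBl scale1r scalerA.
have exp2 (X : 'M[C]_3) : \tr (q' *m X *m adj q') = c * c^*%C * \tr (q *m X *m adj q)
   + c * t%:C * \tr (q *m X *m adj b) + t%:C * c^*%C * \tr (b *m X *m adj q)
   + t%:C * t%:C * \tr (b *m X *m adj b).
  by rewrite q'E tr_form2 conjc_real.
have nE : (sqnorm q')%:C = c * c^*%C * (sqnorm q)%:C + t%:C * t%:C * (sqnorm b)%:C.
  have := exp2 1%:M; rewrite !mulmx1 !trn bq mxtrace0 mulr0 addr0 => ->.
  by rewrite (mul_adjC bq) mxtrace0 mulr0 addr0.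
have cc : c + c^*%C = 2%:R - t%:C * (2%:R * (complex.Re z)%:C).
  rewrite -addcJ /c; have -> : (1 - t%:C * z)^*%C = 1 - t%:C * z^*%C.
    by rewrite conjcB conjc1 conjcM conjc_real.
  ring.
have two : (2%:R : C) != 0 by rewrite pnatr_eq0.
have tE : tau = (\tr H - rho) / 2%:R by rewrite /tau (half_trE q0).
rewrite (half_trE q'0) exp2 hqq hqb hbq hbb.
set N := (sqnorm q)%:C in n0 nE *; set N' := (sqnorm q')%:C in n0' nE *.
rewrite [RHS](_ : _ = t%:C * ((sqnorm b)%:C
  * (2%:R + t%:C * (tau - rho - 2%:R * (complex.Re z)%:C)) / (2%:R * N'))); last first.
  have cM (x y : R) : (x * y)%:C = x%:C * y%:C by exact: rmorphM.
  have cD (x y : R) : (x + y)%:C = x%:C + y%:C by exact: rmorphD.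
  have cN (x : R) : (- x)%:C = - x%:C by exact: rmorphN.
  have c2 : (2 : R)%:C = 2%:R by exact: rmorph_nat.
  by rewrite !(cM, cD, cN, rcinv, c2) -tauE -rhoE.
rewrite rcinv -/N'.
have trHE : \tr H = 2%:R * tau + rho by rewrite tE mulrC divfK // subrK.
have csE : c^*%C = 2%:R - t%:C * (2%:R * (complex.Re z)%:C) - c by rewrite -cc addrC addKr.
set beta := (sqnorm b)%:C in nE *; set s := t%:C in nE csE *.
set zr := (complex.Re z)%:C in csE *; set cs := c^*%C in nE csE *.
move: (\tr H) trHE {tE hqb hbq hbb hqq exp2 trn tauE rhoE cc} => h hE.
have -> : tau - (h - N'^-1 * (c * cs * (rho * N) + c * s * beta + s * cs * beta
   + s * s * (tau * beta))) / 2%:R = (c * cs * (rho * N) + c * s * beta + s * cs * beta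
   + s * s * (tau * beta) - rho * N') / (2%:R * N').
  by rewrite hE; field.
have -> : c * cs * (rho * N) + c * s * beta + s * cs * beta + s * s * (tau * beta) - rho * N'
  = s * (beta * (2%:R + s * (tau - rho - 2%:R * zr))).
  by rewrite nE csE; ring.
by rewrite !mulrA.
Qed.

End Degenerate.

(** * Maximality *)

Section Maximality.
Variable R : realType.
Local Notation V := 'rV[R]_4.
Local Notation C := R[i].

(** A one-sided limit, because the two half-paths through x behave differently. *)
Lemma vanish_limit (f : V -> R) (x X : V) (eps : R) : 0 < eps ->
  {for x, continuous f} -> (forall t, 0 < t < eps -> f (x + t *: X) = 0) -> f x = 0.
Proof.
move=> e0 fc f0.
have gc : {for 0, continuous (fun t : R => f (x + t *: X))}.
  apply: (@continuous_comp _ _ _ (fun t : R => x + t *: X) f).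
    apply: cvgD; first exact: cvg_cst.
    by apply: cvgZr_tmp; exact: cvg_id.
  by rewrite /= scale0r addr0.
have h1 : f (x + t *: X) @[t --> 0^'+] --> f x.
  have := cvg_at_right_filter gc.
  by rewrite scale0r addr0.
have h2 : f (x + t *: X) @[t --> 0^'+] --> (0 : R).
  apply: cvg_near_cst; near=> t; apply: f0; apply/andP; split; near: t.
    exact: nbhs_right_gt.
  exact: nbhs_right_lt.
exact: (cvg_unique _ h1 h2).
Unshelve. all: by end_near. Qed.

Lemma chart_surj (w : P2 R) : exists k x, w = chart k x.
Proof.
have [k hk] : exists k, Defs.hom w 0 k != 0.
  apply: contrapT => h; have := hom_neq0 w; case/eqP; apply/rowP => k.
  by rewrite [RHS]mxE; apply/eqP/negPn/negP => hk; apply: h; exists k.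
exists k, (coords k (Defs.hom w)); rewrite -[LHS]pt_hom; apply/pt_eqP.
exists (Defs.hom w 0 k); apply/rowP => j; rewrite mxE.
rewrite /chart_vec /insert mxE; case: unliftP => [m ->|->]; last by rewrite mulr1.
have -> : zvec (coords k (Defs.hom w)) = \row_m (Defs.hom w 0 (lift k m) / Defs.hom w 0 k).
  rewrite /coords zvec_row; apply/rowP => n; rewrite !mxE.
  by case: (_ / _).
by rewrite mxE mulrC divfK.
Qed.

Variables (H : 'M[C]_3) (HH : adj H = H) (tr : eigen_transverse H).

(** Through a point where the compression is scalar there is a path along which a fixed
    vector n stays in the eigenline of +1 for t > 0 and in that of -1 for t < 0. *)
Lemma sign_along_path k (x : V) : disc H (chart_vec k x) = 0 ->
  exists (n : 'rV[C]_3) (X : V) (eps : R), [/\ n != 0, n *m adj (chart_vec k x) = 0, 0 < eps &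
   forall t : R, `|t| < eps -> t != 0 ->
     0 < disc H (chart_vec k (x + t *: X)) /\
     n *m splitting H (chart_vec k (x + t *: X)) = (Num.sg t)%:C *: n].
Proof.
move=> d0; set q := chart_vec k x in d0 *.
have q0 : q != 0 by exact: chart_vec_neq0.
pose b := tilt H q; have b0 : b != 0 by exact: tilt_neq0.
have bq : b *m adj q = 0 by exact: tilt_adj.
pose n := cross (adj q) (adj b).
have n0 : n != 0.
  by have := cross_adj_neq0 q0 (adj_neq0 b0) (oner_neq0 _) (mul_adjC bq); rewrite scale1r.
have nq : n *m adj q = 0 by exact: cross_mull.
have nb : n *m adj b = 0 by exact: cross_mulr.
have nH : n *m H = half_tr H q *: n by exact: degenerate_eigen.
pose z := b 0 k; pose X := real_row (b *m aff k x).
(* The direction X is chosen so that the chart point at time t is q + t (b - z q);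
   subtracting z q keeps the k-th coordinate equal to 1. *)
pose kappa := complex.Re (half_tr H q) -
  complex.Re ((sqnorm q)^-1%:C * \tr (q *m H *m adj q)) - 2 * complex.Re z.
have qt t : chart_vec k (x + t *: X) = q + t%:C *: (b - z *: q).
  rewrite !chart_vecE zvecD zvecZ real_rowK mulmxDl addrA -chart_vecE -/q; congr (_ + _).
  rewrite -scalemxAl -mulmxA aff_inc -/q mulmxBr mulmx1 mulmxA; congr (_ *: (_ - _)).
  by rewrite mul_ecol mul_scalar_mx.
(* For |t| below this bound |t kappa| < 1, so 2 + t kappa stays positive. *)
exists n, X, (1 + `|kappa|)^-1; split; [exact: n0 | exact: nq | |].
  by rewrite invr_gt0 ltr_pwDl.
move=> t te t0.
have q't : chart_vec k (x + t *: X) != 0 by exact: chart_vec_neq0.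
have kt : `|t * kappa| < 1.
  rewrite normrM (le_lt_trans (y := `|t| * (1 + `|kappa|))) //.
    by rewrite ler_wpM2l // ler_wpDl.
  by rewrite -ltr_pdivlMr ?ltr_pwDl // mul1r.
have pos : 0 < 2 + t * kappa by move: kt; rewrite ltr_norml => /andP[]; lra.
have sq'0 := sqnorm_gt0 q't; have sb0 := sqnorm_gt0 b0.
have := @half_tr_along_path R H HH q z t q0 d0; cbv zeta; rewrite -/b -/kappa -qt => /(_ q't).
set m := t * _ => hm.
have mE : m = t * (sqnorm b * (2 + t * kappa) / (2 * sqnorm (chart_vec k (x + t *: X)))) by [].
have fp : 0 < sqnorm b * (2 + t * kappa) / (2 * sqnorm (chart_vec k (x + t *: X))).
  by rewrite divr_gt0 // mulr_gt0.
have m0 : m != 0 by rewrite mE mulf_neq0 // gt_eqF.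
have nq' : n *m adj (chart_vec k (x + t *: X)) = 0.
  rewrite qt adjmxD adjmxZ adjmxB adjmxZ mulmxDr nq -scalemxAr mulmxBr nb -scalemxAr nq.
  by rewrite scaler0 subr0 scaler0 addr0.
have [dp nT] := splitting_eigen HH q't n0 nq' nH hm m0.
by split=> //; rewrite nT mE sgrM (gtr0_sg fp) mulr1.
Qed.

(** At a point outside U, the path of sign_along_path gives a tangent direction on which the
    structure tends to i from one side and to -i from the other, so no continuous J'
    extends it. *)
Lemma jfield_maximal (U : set (P2 R)) (W : set (P2 R)) (J' : endo_field R) :
  (forall k x, U (chart k x) <-> 0 < disc H (chart_vec k x)) ->
  U `<` W -> is_OCS W J' -> ~ eq_on U J' (jfield H).
Proof.
move=> UE [UW /existsNP [w /not_implyP [Ww Uw]]] oJ eJ.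
have [k [x xE]] := chart_surj w; rewrite xE in Ww Uw.
have d0 : disc H (chart_vec k x) = 0.
  apply/eqP/negPn/negP => d; apply: Uw; apply/UE.
  by rewrite lt_neqAle eq_sym d disc_ge0 // chart_vec_neq0.
have [n [X [eps [n0 nq e0 hn]]]] := sign_along_path d0.
pose D := chart k @^-1` W.
have oD : open D by exact: (ocs_open oJ).
(* F is J' applied to the tangent vector of n, and G is i times that vector. *)
pose G y := real_row ('i *: (n *m aff k y)).
pose F y := real_row (n *m aff k y) *m J' k y.
have sA : msmooth D (fun y => n *m aff k y).
  by apply: msmooth_mul => //; [exact: msmooth_cst | exact: msmooth_aff].
have sG : smooth_on D G.
  by apply: smooth_real_row => //; apply: msmooth_scale => //; exact: csmooth_cst.
have sF : smooth_on D F.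
  by apply: smooth_mulmx => //; [exact: smooth_real_row | exact: (ocs_smooth oJ)].
have FG t : `|t| < eps -> t != 0 ->
    F (x + t *: X) = Num.sg t *: G (x + t *: X).
  move=> te t0; have [dp nT] := hn t te t0.
  have Ut : U (chart k (x + t *: X)) by apply/UE.
  apply: (@zvec_inj R); rewrite /F (eJ _ _ Ut) zvec_jfield real_rowK -mulmxA aff_jmx //.
  rewrite -scalemxAr mulmxA nT.
  by rewrite zvecZ real_rowK -scalemxAl !scalerA mulrC.
have cont (c : R) j : {for x, continuous (fun y => F y 0 j + c * G y 0 j)}.
  have s : Cn 0 D (fun y => F y 0 j + c * G y 0 j).
    apply: Cn_add => //; first exact: smooth_entry.
    apply: Cn_mul => //; [exact: (Cn_cst oD) | exact: smooth_entry].
  by apply: s; rewrite inE.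
have FpG j : F x 0 j + (-1) * G x 0 j = 0.
  apply: (@vanish_limit _ x X eps e0 (cont (-1) j)) => t /andP[t0 te].
  have := FG t; rewrite (gtr0_norm t0) te (gt_eqF t0) (gtr0_sg t0) => ->//.
  by rewrite scale1r mulN1r subrr.
have FmG j : F x 0 j + 1 * G x 0 j = 0.
  apply: (@vanish_limit _ x (- X) eps e0 (cont 1 j)) => t /andP[t0 te].
  have -> : t *: - X = (- t) *: X by rewrite scaleNr scalerN.
  have := FG (- t); rewrite normrN (gtr0_norm t0) te oppr_eq0 (gt_eqF t0) sgrN (gtr0_sg t0) => ->//.
  by rewrite scaleN1r mxE mul1r addNr.
have G0 : G x = 0.
  apply/rowP => j; rewrite [RHS]mxE; have := FpG j; have := FmG j; lra.
have na : n *m aff k x = 0.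
  have := congr1 (@zvec R) G0; rewrite real_rowK zvec0 => /eqP.
  rewrite scaler_eq0 => /orP[|/eqP //].
  by rewrite eq_complex /= oner_eq0 andbF.
have : n *m (aff k x *m inc R k) = 0 by rewrite mulmxA na mul0mx.
rewrite aff_inc mulmxBr mulmx1 => /subr0_eq nE.
case/eqP: n0; rewrite -(mul_perp_id nq) nE -!mulmxA mul_perp ?mulmx0 //.
exact: chart_vec_neq0.
Qed.
End Maximality.

Theorem corollary7p4 (R : realType) (A : 'M[R[i]]_3) (S : set (flag R))
    (A_nonscalar : ~~ is_scalar_mx A) (S_eq : S = surface A)
    (S_smooth : smooth_surface A)
    (S_jinv : @flag_j R @` S = S) :
  exists JS : endo_field R,
    is_OCS (~` D0 S) JS /\
    forall (W : set (P2 R)) (J' : endo_field R),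
      ~` D0 S `<` W -> is_OCS W J' ->
      ~ eq_on (~` D0 S) J' JS.
Proof.
rewrite {}S_eq in S_jinv *.
have [H [a [b [HH a0 AE]]]] := normal_form S_smooth S_jinv.
have UE k x : (~` D0 (surface A)) (chart k x) <-> 0 < disc H (chart_vec k x).
  rewrite /setC /= (D0_disc (chart_vec_neq0 k x) HH a0 AE) lt_neqAle disc_ge0 ?chart_vec_neq0 //.
  by rewrite andbT eq_sym; split=> /eqP.
have tr : eigen_transverse H.
  move=> p l c p0 l0 pH Hl.
  apply: (no_common_eigen (a := a * c + b) S_smooth) => //.
    by rewrite AE mulmxDr -scalemxAr pH mul_mx_scalar scalerA scalerDl.
  by rewrite AE mulmxDl -scalemxAl Hl mul_scalar_mx scalerA scalerDl.
exists (jfield H); split; first exact: jfield_is_OCS.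
by move=> W J' UW oJ; exact: (jfield_maximal HH tr UE UW oJ).
Qed.
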